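(* Let $s$ be a compound Poisson process with Poisson parameter $\lambda>0$ whose law of jumps $\mathcal{P}$ admits a probability density function, has zero mean and has finite variance. Let $\mathrm{MSE}_M^{\rm greedy}=\mathbb{E}\big[\|s-\mathrm{P}_M^{\rm greedy}(s)\|_{L_2([0,1])}^2\big]$ be the mean-squared error of the greedy Haar approximation of $s$ on $[0,1]$, and let $N$ be a Poisson random variable with parameter $\lambda$. Then there exist constants $C_1,C_2>0$ (not depending on $M$) such that for every integer $M\geq 1$, $$C_1\, M^{-1}\,\mathbb{E}\big[2^{-\frac{M}{N}}\big]\;\leq\;\mathrm{MSE}_M^{\rm greedy}\;\leq\; C_2\, M\,\mathbb{E}\big[2^{-\frac{M}{N}}\big],$$ where $2^{-M/N}$ is understood as $0$ on the event $\{N=0\}$.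
   Context: Compound Poisson process with parameters $(\mathcal{P},\lambda)$: let $\{\tau_k\}$ be a stationary Poisson point process on $\mathbb{R}$ with rate $\lambda>0$, and let $\{a_k\}$ be i.i.d. random variables with law $\mathcal{P}$, independent of $\{\tau_k\}$. Then $s$ is the piecewise-constant process with $s(0)=0$ and weak derivative $\sum_k a_k\delta(\cdot-\tau_k)$; for $t\in[0,1]$, $s(t)=\sum_{k:\,0<\tau_k\leq t}a_k$. All processes are restricted to $[0,1]$. Haar basis of $L_2([0,1])$: $\phi=\mathbb{1}_{[0,1]}$, $\psi=\mathbb{1}_{[0,1/2]}-\mathbb{1}_{[1/2,1]}$, $\psi_{j,k}=2^{j/2}\psi(2^j\cdot-k)$ for $j\geq 0$, $0\leq k\leq 2^j-1$. The orthonormal basis is $\{\phi\}\cup\{\psi_{j,k}\}_{j\geq 0,\,0\leq k\leq 2^j-1}$, ordered by the index $\mathrm{Ind}(\phi)=0$, $\mathrm{Ind}(\psi_{j,k})=2^j+k$. Greedy approximation: for $f\in L_2([0,1])$, $\mathrm{P}_M^{\rm greedy}(f)$ is the partial Haar expansion of $f$ obtained by keeping only the first $M$ nonzero coefficients among $\langle f,\phi\rangle,\langle f,\psi_{j,k}\rangle$ (first with respect to $\mathrm{Ind}$), and discarding all others; if $f$ has fewer than $M$ nonzero coefficients, all are kept. *)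

(* Defs.v *)
From HB Require Import structures.
From mathcomp Require Import all_boot all_order all_algebra.
From mathcomp Require Import all_classical all_reals all_analysis.
From mathcomp Require Import measurable_realfun.
Set Implicit Arguments.
Unset Strict Implicit.
Unset Printing Implicit Defensive.
Import Order.TTheory GRing.Theory Num.Theory.
Import numFieldNormedType.Exports.
Local Open Scope classical_set_scope.
Local Open Scope ring_scope.

Definition mutually_independent d d' (T : measurableType d)
    (T' : measurableType d') (R : realType) (P : probability T R)
    (I : choiceType) (X : I -> T -> T') : Prop :=
  forall (J : seq I) (B : I -> set T'),
    uniq J -> (forall i, measurable (B i)) ->
    P (\bigcap_(i in [set` J]) (X i @^-1` B i)) =
      (\prod_(i <- J) P (X i @^-1` B i))%E.

Definition sigma_of_family d' (T : Type) (T' : measurableType d') (I : Type)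
    (X : I -> T -> T') : set (set T) :=
  <<s \bigcup_i preimage_set_system setT (X i) measurable >>.

Definition independent_families d d1 d2 (T : measurableType d)
    (T1 : measurableType d1) (T2 : measurableType d2)
    (R : realType) (P : probability T R) (I1 I2 : Type)
    (X : I1 -> T -> T1) (Y : I2 -> T -> T2) : Prop :=
  forall A B : set T, sigma_of_family X A -> sigma_of_family Y B ->
    P (A `&` B) = (P A * P B)%E.

Section compound_poisson.
Context {d : measure_display} {T : measurableType d} {R : realType}.
Variable P : probability T R.

(* Number, possibly infinite, of points of [tau] lying in [A]. *)
Definition point_count (tau : nat -> T -> R) (A : set R) (w : T) : \bar R :=
  counting [set k | A (tau k w)].

(* The points are given by an arbitrary measurable enumeration; no ordering of
   the [tau k] is assumed. The second argument of [poisson_prob] is a dummy, and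
   [poisson_prob 0] is the Dirac mass at 0, so null sets [A] are covered. *)
Record poisson_point_process (lambda : R) (tau : nat -> {RV P >-> R}) : Prop := {
  poisson_point_count : forall (A : set R) (n : nat), measurable A ->
    (lebesgue_measure A < +oo)%E ->
    P [set w | point_count tau A w = n%:R%:E] =
      poisson_prob (lambda * fine (lebesgue_measure A)) 0 [set n] ;
  poisson_point_indep : forall B : nat -> set R, (forall i, measurable (B i)) ->
    trivIset setT B ->
    mutually_independent P (fun i => point_count tau (B i)) }.

Definition iid_with_law (Pa : probability R R) (a : nat -> {RV P >-> R}) : Prop :=
  mutually_independent P (fun k => a k : T -> R) /\
  forall k (A : set R), measurable A -> distribution P (a k) A = Pa A.

(* Almost surely, only finitely many [tau k] lie in [`]0, 1]]; on the exceptional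
   null event, a sum with infinitely many nonzero terms is 0 by convention of
   the [\sum_(_ \in _)] operator. *)
Definition is_compound_poisson (lambda : R) (Pa : probability R R)
    (s : R -> T -> R) : Prop :=
  exists (tau a : nat -> {RV P >-> R}),
    [/\ poisson_point_process lambda tau,
        iid_with_law Pa a,
        independent_families P (fun k => a k : T -> R) (fun k => tau k : T -> R) &
        forall t w, 0 <= t <= 1 ->
          s t w = \sum_(k \in [set k | 0 < tau k w <= t]) a k w].

End compound_poisson.

Definition admits_density (R : realType) (Q : probability R R) : Prop :=
  exists p : R -> R, [/\ measurable_fun setT p, (forall x, 0 <= p x) &
    forall A : set R, measurable A ->
      Q A = (\int[lebesgue_measure]_(x in A) (p x)%:E)%E].

Section haar.
Context {R : realType}.
Implicit Types (f : R -> R) (j k n M : nat) (x : R).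

Definition haar_phi x : R := \1_(`[0, 1]) x.

Definition haar_mother x : R := \1_(`[0, 1 / 2]) x - \1_(`[1 / 2, 1]) x.

Definition haar_psi j k x : R :=
  2 `^ (j%:R / 2) * haar_mother (2 ^+ j * x - k%:R).

(* The basis listed along its index: every n > 0 is uniquely 2 ^ j + k with
   k <= 2 ^ j - 1, and then j = trunc_log 2 n. *)
Definition haar n : R -> R :=
  if n == 0 then haar_phi
  else haar_psi (trunc_log 2 n) (n - 2 ^ trunc_log 2 n).

Definition haar_coef f n : R :=
  \int[lebesgue_measure]_(x in `[0, 1]) (f x * haar n x).

Definition greedy_indices M f : set nat :=
  [set n | haar_coef f n != 0 /\
           (count (fun m => haar_coef f m != 0%R) (iota 0 n) < M)%N].

Definition greedy_approx M f x : R :=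
  \sum_(n \in greedy_indices M f) haar_coef f n * haar n x.

Definition sq_L2_norm01 f : \bar R :=
  (\int[lebesgue_measure]_(x in `[0%R, 1%R]) ((f x) ^+ 2)%:E)%E.

Definition mse_greedy d (T : measurableType d) (P : probability T R)
    (s : R -> T -> R) M : \bar R :=
  (\int[P]_w sq_L2_norm01 (fun x => (s x w - greedy_approx M (s ^~ w) x)%R))%E.

(* 2 ^ (- M / n), read as 0 for n = 0. *)
Definition exp2_neg_ratio M n : R :=
  if n == 0 then 0 else 2 `^ (- (M%:R / n%:R)).

End haar.

(* Main.v *)
(** Suppose that there are n jumps in ]0, 1]. Every Haar level has at most n
    nonzero coefficients, so the greedy approximation contains all the levels
    below J = (M - 1) / n. The jump heights being centred, independent of each
    other and of the jump times, the cross terms of the error vanish in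
    expectation and the error is at most n sigma^2 2^-J.
    Conversely, with probability at least 1/2 the n jumps fall into distinct
    cells of a dyadic partition of between n^2 and 2 n^2 cells. Then every finer
    level has exactly n nonzero coefficients, the greedy approximation stops
    after about M / n of these levels, and each of the n jumps contributes to
    the error a coefficient of the next level, whose square has order
    sigma^2 2^-level.
    Against the Poisson weights the terms n > M are harmless: n p_n is
    lambda p_(n-1) above, and p_n is dominated by p_M below. *)

Require Import Defs.
From HB Require Import structures.
From mathcomp Require Import all_boot all_order all_algebra finmap.
From mathcomp Require Import all_classical all_reals all_analysis.
From mathcomp Require Import measurable_realfun lra ring zify.
Import Order.TTheory GRing.Theory Num.Theory.
Import numFieldNormedType.Exports.
Set Implicit Arguments.
Unset Strict Implicit.
Unset Printing Implicit Defensive.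
Local Open Scope classical_set_scope.
Local Open Scope ring_scope.

(** * Step functions and the Haar basis *)

(** On each path the process is a finite combination of Heaviside functions, so norms and
    coefficients reduce to an explicit bilinear form on lists of jumps; Bessel's inequality replaces
    completeness of the Haar basis. The number of kept levels depends on the number of jumps, and
    the points come in an arbitrary enumeration, so no conditional law of n uniform points is at
    hand. The upper bound therefore splits over the countably many finite sets S of indices whose
    points fall in ]0, 1]: on each such event the sum over jumps has a deterministic index set. The
    lower bound splits over the sets A of occupied cells of a dyadic partition, whose probabilities
    follow from the independence of counts. Both kinds of event depend on the jump times only, so
    the heights integrate out separately. A jump close to the end of its cell gives a tiny
    coefficient. The lower bound retains only jumps in the middle half of a cell, which carry half
    of the mass. Separating n jumps takes about n^2 cells, so n coefficients of square about n^-2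
    leave a factor 1/n, at least 1/M for n <= M. *)

Section step.
Context {R : realType}.
Local Notation mu := (@lebesgue_measure R).
Implicit Types (s u : seq (R * R)) (x y t : R).

Definition heaviside x t : R := (x <= t)%R%:R.

Definition step s t : R := \sum_(p <- s) p.1 * heaviside p.2 t.

Definition in01 s := all (fun p => 0 <= p.2 <= 1) s.

(* The inner product of [step s] and [step u] in L2([0, 1]): two Heaviside
   functions with jumps at [x] and [y] have inner product 1 - max x y. *)
Definition step_form s u : R :=
  \sum_(p <- s) \sum_(q <- u) p.1 * q.1 * (1 - Num.max p.2 q.2).

Lemma step_form_catl s s' u : step_form (s ++ s') u = step_form s u + step_form s' u.
Proof. by rewrite /step_form big_cat. Qed.

Lemma step_formC s u : step_form s u = step_form u s.
Proof.
rewrite /step_form exchange_big; apply: eq_bigr => p _; apply: eq_bigr => q _ /=.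
by rewrite maxC (mulrC p.1).
Qed.

Lemma step_form_catr s u u' : step_form s (u ++ u') = step_form s u + step_form s u'.
Proof. by rewrite step_formC step_form_catl !(step_formC s). Qed.

Definition scale (c : R) s := [seq (c * p.1, p.2) | p <- s].

Lemma step_form_scalel c s u : step_form (scale c s) u = c * step_form s u.
Proof.
rewrite /step_form big_map mulr_sumr; apply: eq_bigr => p _ /=.
by rewrite mulr_sumr; apply: eq_bigr => q _; rewrite !mulrA.
Qed.

Lemma step_form_flattenl (I : Type) (r : seq I) (F : I -> seq (R * R)) u :
  step_form (flatten [seq F i | i <- r]) u = \sum_(i <- r) step_form (F i) u.
Proof.
elim: r => [|i r IH] /=; first by rewrite /step_form !big_nil.
by rewrite step_form_catl IH big_cons.
Qed.

Lemma step_cat s u t : step (s ++ u) t = step s t + step u t.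
Proof. by rewrite /step big_cat. Qed.

Lemma step_scale c s t : step (scale c s) t = c * step s t.
Proof.
by rewrite /step big_map mulr_sumr; apply: eq_bigr => p _ /=; rewrite mulrA.
Qed.

Lemma step_flatten (I : Type) (r : seq I) (F : I -> seq (R * R)) t :
  step (flatten [seq F i | i <- r]) t = \sum_(i <- r) step (F i) t.
Proof.
elim: r => [|i r IH] /=; first by rewrite /step !big_nil.
by rewrite step_cat IH big_cons.
Qed.

Lemma heaviside2 x y t : heaviside x t * heaviside y t = \1_(`[Num.max x y, +oo[) t.
Proof.
rewrite /heaviside indicE mem_setE in_itv /= andbT ge_max.
by case: (x <= t); case: (y <= t); rewrite ?mulr0 ?mulr1 ?mul0r.
Qed.

Lemma integral_heaviside2 x y : 0 <= x <= 1 -> 0 <= y <= 1 ->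
  (\int[mu]_(t in `[0%R, 1%R]) (heaviside x t * heaviside y t)%:E =
   (1 - Num.max x y)%:E)%E.
Proof.
move=> /andP[x0 x1] /andP[y0 y1].
under eq_integral do rewrite heaviside2.
rewrite integral_indic//.
have -> : `[Num.max x y, +oo[%classic `&` `[0, 1] = `[Num.max x y, 1]%classic :> set R.
  apply/seteqP; split => t /=; rewrite !in_itv /= ?andbT.
    by move=> [-> /andP[_ ->]].
  by move=> /andP[h ->]; rewrite h (le_trans _ h)// le_max x0.
rewrite [LHS]lebesgue_measure_itv /= lte_fin; case: ltgtP => //.
- by rewrite lt_max !ltNge x1 y1.
- by move=> ->; rewrite subrr.
Qed.

Lemma integrable_heaviside2 x y :
  mu.-integrable `[0, 1] (fun t => (heaviside x t * heaviside y t)%:E).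
Proof.
rewrite (_ : (fun t => _) = EFin \o \1_(`[Num.max x y, +oo[)); last first.
  by apply/funext => t; rewrite heaviside2.
apply: measurable_bounded_integrable => //.
- by rewrite [X in (X < _)%E]lebesgue_measure_itv /= lte_fin ltr01 -EFinB ltry.
- exists 1; split => // r r1 t _ /=; rewrite indicE ger0_norm//.
  by apply: le_trans (ltW r1); case: (_ \in _).
Qed.

Lemma step2E s u t : (step s t * step u t)%:E =
  (\sum_(p <- s) \sum_(q <- u)
     (p.1 * q.1)%:E * (heaviside p.2 t * heaviside q.2 t)%:E)%E.
Proof.
rewrite /step mulr_suml -sumEFin; apply: eq_bigr => p _.
rewrite mulr_sumr -sumEFin; apply: eq_bigr => q _.
by rewrite -EFinM; congr EFin; ring.
Qed.

Lemma integral_step2 s u : in01 s -> in01 u ->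
  (\int[mu]_(t in `[0%R, 1%R]) (step s t * step u t)%:E = (step_form s u)%:E)%E.
Proof.
move=> s01 u01; under eq_integral do rewrite step2E.
rewrite integral_sum//; last first.
  move=> p; apply: integrable_sum => // q _.
  by apply: integrableZl => //; exact: integrable_heaviside2.
rewrite /step_form -sumEFin big_seq [RHS]big_seq; apply: eq_bigr => p ps.
rewrite integral_sum//; last first.
  by move=> q; apply: integrableZl => //; exact: integrable_heaviside2.
rewrite -sumEFin big_seq [RHS]big_seq; apply: eq_bigr => q qu.
rewrite integralZl//; last exact: integrable_heaviside2.
by rewrite integral_heaviside2 ?(allP s01 _ ps) ?(allP u01 _ qu).
Qed.

Lemma step_form_ge0 s : in01 s -> 0 <= step_form s s.
Proof.
move=> s01; rewrite -lee_fin -integral_step2//.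
by apply: integral_ge0 => t _; rewrite lee_fin -expr2 sqr_ge0.
Qed.

Lemma measurable_step s D : measurable_fun D (step s).
Proof.
apply: measurable_funS (@measurableT _ _) (@subsetT _ _) _.
apply: measurable_sum => p; apply: measurable_funM => //.
rewrite [X in measurable_fun _ X](_ : _ = \1_(`[p.2, +oo[)) //.
by apply/funext => t; rewrite indicE mem_setE in_itv /= andbT.
Qed.

End step.

Section haar_step.
Context {R : realType}.
Local Notation mu := (@lebesgue_measure R).
Implicit Types (s u : seq (R * R)) (x y t : R) (j k n : nat).

Definition dyad j k : R := k%:R * (2 ^+ j)^-1.

Definition amp j : R := 2 `^ (j%:R / 2).

Lemma amp2 j : amp j * amp j = 2 ^+ j.
Proof. by rewrite /amp -powRD ?pnatr_eq0 ?implybT// -splitr powR_mulrn. Qed.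

(* [step (haar_seq n)] agrees with [haar n] except at the breakpoints, where the
   closed intervals in the definition of [haar_mother] overlap. *)
Definition haar_seq n : seq (R * R) :=
  if n == 0 then [:: (1, 0)] else
    let j := trunc_log 2 n in let k := (n - 2 ^ trunc_log 2 n)%N in
    [:: (amp j, dyad j k); (- 2 * amp j, dyad j.+1 (k.*2.+1)); (amp j, dyad j k.+1)].

Lemma trunc_log_cell j k : (k < 2 ^ j)%N -> trunc_log 2 (2 ^ j + k) = j.
Proof.
by move=> kj; apply: trunc_log_eq => //; rewrite leq_addr/= expnS mul2n -addnn ltn_add2l.
Qed.

Lemma haar_seqE j k : (k < 2 ^ j)%N -> haar_seq (2 ^ j + k) =
  [:: (amp j, dyad j k); (- 2 * amp j, dyad j.+1 (k.*2.+1)); (amp j, dyad j k.+1)].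
Proof.
move=> kj; rewrite /haar_seq addn_eq0 expn_eq0/= trunc_log_cell//.
by rewrite addKn.
Qed.

Lemma haar_indexP n : n = 0%N \/ exists j k, (k < 2 ^ j)%N /\ n = (2 ^ j + k)%N.
Proof.
case: n => [|n]; [by left|right].
have /= /andP[h1 h2] := @trunc_log_bounds 2 n.+1 isT isT.
exists (trunc_log 2 n.+1), (n.+1 - 2 ^ trunc_log 2 n.+1)%N.
by move: h2 => /=; rewrite expnS mul2n -addnn => h2; split; lia.
Qed.

Lemma dyad_ge0 j k : 0 <= dyad j k.
Proof. by rewrite mulr_ge0// invr_ge0 exprn_ge0. Qed.

Lemma dyad_le j k k' : (k <= k')%N -> dyad j k <= dyad j k'.
Proof. by move=> h; rewrite ler_wpM2r ?ler_nat// invr_ge0 exprn_ge0. Qed.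

Lemma dyad_lt j k k' : (k < k')%N -> dyad j k < dyad j k'.
Proof. by move=> h; rewrite ltr_pM2r ?ltr_nat// invr_gt0 exprn_gt0. Qed.

Lemma dyad1 j : dyad j (2 ^ j) = 1.
Proof. by rewrite /dyad natrX divff// expf_neq0. Qed.

Lemma dyad_le1 j k : (k <= 2 ^ j)%N -> dyad j k <= 1.
Proof. by move=> h; rewrite -(dyad1 j) dyad_le. Qed.

Lemma dyad_double j k : dyad j.+1 k.*2 = dyad j k.
Proof. by rewrite /dyad -mul2n natrM exprS invfM mulrACA divff// mul1r. Qed.

Lemma dyad_mulX i j k : dyad (j + i) (k * 2 ^ i) = dyad j k.
Proof.
elim: i => [|i IH]; first by rewrite addn0 muln1.
by rewrite addnS expnS mulnCA mul2n dyad_double.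
Qed.

Lemma dyadS j k : dyad j k.+1 = dyad j k + (2 ^+ j)^-1.
Proof. by rewrite /dyad -natr1 mulrDl mul1r. Qed.

Lemma in01_haar_seq n : in01 (haar_seq n).
Proof.
have [->|[j [k [kj ->]]]] := haar_indexP n; first by rewrite /= lexx ler01.
rewrite haar_seqE//= !dyad_ge0 !dyad_le1 ?(ltnW kj)//.
by rewrite expnS; lia.
Qed.

Lemma haar_stepE n t : 0 <= t <= 1 -> t \notin [seq p.2 | p <- haar_seq n] ->
  haar n t = step (haar_seq n) t.
Proof.
move=> t01; have [->|[j [k [kj ->]]]] := haar_indexP n.
  move=> _; rewrite /haar /haar_phi /step /haar_seq eqxx big_seq1 /heaviside/=.
  by rewrite indicE mem_setE in_itv/= t01 mul1r; case/andP: t01 => ->.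
rewrite haar_seqE//= !inE !negb_or => /and3P[t1 t2 t3].
rewrite /haar addn_eq0 expn_eq0/= trunc_log_cell// addKn /haar_psi /haar_mother.
rewrite /step !big_cons big_nil /= !indicE !mem_setE !in_itv/= addr0 /heaviside.
rewrite -/(amp j).
have D0 : 0 < (2 ^+ j : R) by rewrite exprn_gt0.
have Ek : k.*2.+1%:R = 2 * k%:R + 1 :> R.
  by rewrite -[LHS]natr1 -muln2 natrM mulrC.
have E1 : (0 <= 2 ^+ j * t - k%:R) = (dyad j k <= t).
  by rewrite subr_ge0 /dyad ler_pdivrMr// mulrC.
have E2 : (2 ^+ j * t - k%:R <= 1/2) = (t <= dyad j.+1 k.*2.+1).
  rewrite lerBlDr /dyad ler_pdivlMr ?exprn_gt0// exprS Ek.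
  by rewrite -(@ler_pM2l _ 2)//; congr (_ <= _); field.
have E3 : (1/2 <= 2 ^+ j * t - k%:R) = (dyad j.+1 k.*2.+1 <= t).
  rewrite lerBrDr /dyad ler_pdivrMr ?exprn_gt0// exprS Ek.
  by rewrite -(@ler_pM2l _ 2)//; congr (_ <= _); field.
have E4 : (2 ^+ j * t - k%:R <= 1) = (t <= dyad j k.+1).
  by rewrite lerBlDr /dyad ler_pdivlMr// (mulrC t) -[k.+1%:R]natr1 addrC.
rewrite E1 E2 E3 E4.
have h1 : dyad j k < dyad j.+1 k.*2.+1 by rewrite -dyad_double dyad_lt.
have h2 : dyad j.+1 k.*2.+1 < dyad j k.+1.
  by rewrite -[X in _ < X]dyad_double dyad_lt// doubleS.
move: t1 t2 t3; rewrite !neq_lt.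
case: (ltgtP (dyad j k) t) => //= c1; case: (ltgtP (dyad j.+1 k.*2.+1) t) => //= c2;
  case: (ltgtP (dyad j k.+1) t) => //= c3 _ _ _; try lra.
Qed.

(** The integral of the [n]-th Haar function over [x, 1]; for n > 0 it is minus a Faber-Schauder hat
    function. *)
Definition haar_tail n x : R := step_form [:: (1, x)] (haar_seq n).

Lemma haar_tail0 x : 0 <= x -> haar_tail 0 x = 1 - x.
Proof.
by move=> x0; rewrite /haar_tail /step_form /haar_seq /= !big_seq1/= mulr1 mul1r max_l.
Qed.

Definition tent j k x : R := amp j *
  (2 * Num.max x (dyad j.+1 k.*2.+1) - Num.max x (dyad j k) - Num.max x (dyad j k.+1)).

Lemma haar_tailE j k x : (k < 2 ^ j)%N -> haar_tail (2 ^ j + k) x = tent j k x.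
Proof.
move=> kj; rewrite /haar_tail /step_form big_seq1 haar_seqE// !big_cons big_nil /= /tent.
by rewrite !mul1r; ring.
Qed.

Lemma step_form_haar_tail s n : step_form s (haar_seq n) = \sum_(p <- s) p.1 * haar_tail n p.2.
Proof.
rewrite /haar_tail /step_form; apply: eq_bigr => p _; rewrite big_seq1 mulr_sumr.
by apply: eq_bigr => q _ /=; rewrite !mulrA mulr1.
Qed.

(** Open, because a jump at an end of the cell has coefficient 0. A dyadic jump time thus lies in no
    cell of the fine levels, which is why [count_coef_ge] excludes such times. *)
Definition incell j k x := (dyad j k < x) && (x < dyad j k.+1).

Lemma tentE j k x : dyad j k <= x <= dyad j k.+1 ->
  tent j k x = - (amp j * Num.min (x - dyad j k) (dyad j k.+1 - x)).
Proof.
rewrite /tent => /andP[h1 h2].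
have E : dyad j.+1 k.*2.+1 *+ 2 = dyad j k + dyad j k.+1.
  by rewrite -(dyad_double j k) -(dyad_double j k.+1) doubleS !dyadS; ring.
rewrite (max_l h1) (max_r h2); move: E.
set m := dyad j.+1 _; move=> E; rewrite -[RHS]mulrN; congr (_ * _).
case: (leP x m) => c1; case: (leP (x - dyad j k)) => c2; lra.
Qed.

Lemma tent_out j k x : ~~ incell j k x -> tent j k x = 0.
Proof.
have E : dyad j.+1 k.*2.+1 *+ 2 = dyad j k + dyad j k.+1.
  by rewrite -(dyad_double j k) -(dyad_double j k.+1) doubleS !dyadS; ring.
have h := dyad_lt j (ltnSn k).
rewrite negb_and -!leNgt /tent; move: E; set m := dyad j.+1 _ => E.
move=> /orP[] c; rewrite ?(max_r c) ?(max_l c).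
- by rewrite !max_r; try lra; rewrite (_ : 2 * m - _ - _ = 0) ?mulr0//; lra.
- by rewrite !max_l; try lra; rewrite (_ : 2 * x - _ - _ = 0) ?mulr0//; lra.
Qed.

Lemma amp_gt0 j : 0 < amp j. Proof. exact: powR_gt0. Qed.

Lemma tent_neq0 j k x : (tent j k x != 0) = incell j k x.
Proof.
apply/idP/idP; first by apply: contraNT => /tent_out ->.
move=> /andP[h1 h2]; rewrite tentE ?(ltW h1) ?(ltW h2)// oppr_eq0 mulf_neq0//.
  by rewrite gt_eqF// amp_gt0.
by rewrite gt_eqF// lt_min !subr_gt0 h1.
Qed.

End haar_step.

(** * Orthonormality of the Haar functions and the residual kernel *)

Section ortho.
Context {R : realType}.
Local Notation mu := (@lebesgue_measure R).
Implicit Types (s u : seq (R * R)) (x y t : R) (j k n : nat).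

Lemma dyad_mid j k : (dyad j.+1 k.*2.+1 : R) *+ 2 = dyad j k + dyad j k.+1.
Proof. by rewrite -(dyad_double j k) -(dyad_double j k.+1) doubleS !dyadS; ring. Qed.

(* [haar_seq (2 ^ j + k)] acts on [Num.max ^~ q.2] as a second difference over
   its cell, on which that function is affine. *)
Lemma step_form_haar_far j k u : (k < 2 ^ j)%N ->
  (forall q, q \in u -> q.2 <= dyad j k \/ dyad j k.+1 <= q.2) ->
  step_form (haar_seq (2 ^ j + k)) u = 0.
Proof.
move=> kj far; rewrite step_formC /step_form big_seq big1// => q /far h.
rewrite haar_seqE// !big_cons big_nil /=.
have E := dyad_mid j k; move: E.
have := dyad_lt (R := R) j (ltnSn k).
set l := dyad j k in h *; set m := dyad j.+1 _; set r := dyad j _ in h * => lr E.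
case: h => h.
  rewrite (@max_r _ _ q.2 l)// !max_r; [|lra..].
  rewrite (_ : m = (l + r) / 2); last lra.
  by field.
rewrite (@max_l _ _ q.2 r)// !max_l; [|lra..].
by ring.
Qed.

(** The breakpoints of the coarser function are dyadic of order at most j' + 1 <= j, so none is
    interior to a cell of level [j]. *)
Lemma step_form_haar_lt j k j' k' : (k < 2 ^ j)%N -> (k' < 2 ^ j')%N -> (j' < j)%N ->
  step_form (haar_seq (2 ^ j + k) : seq (R * R)) (haar_seq (2 ^ j' + k')) = 0.
Proof.
move=> kj kj' jj'; apply: step_form_haar_far => // q.
rewrite haar_seqE//.
have D P : dyad j P <= dyad j k :> R \/ dyad j k.+1 <= dyad j P :> R.
  by case: (leqP P k) => h; [left|right]; exact: dyad_le.
have D' P : dyad j' P <= dyad j k :> R \/ dyad j k.+1 <= dyad j' P :> R.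
  by rewrite -(dyad_mulX (j - j') j' P) subnKC ?(ltnW jj')//; exact: D.
have D'' P : dyad j'.+1 P <= dyad j k :> R \/ dyad j k.+1 <= dyad j'.+1 P :> R.
  by rewrite -(dyad_mulX (j - j'.+1) j'.+1 P) subnKC//; exact: D.
by rewrite !inE => /or3P[] /eqP ->; [exact: D'|exact: D''|exact: D'].
Qed.

Lemma step_form_haar_level j k k' : (k < 2 ^ j)%N -> (k' < 2 ^ j)%N -> k != k' ->
  step_form (haar_seq (2 ^ j + k) : seq (R * R)) (haar_seq (2 ^ j + k')) = 0.
Proof.
move=> kj kj' kk'; apply: step_form_haar_far => // q.
rewrite haar_seqE//.
have E := dyad_mid j k'; have lr := dyad_lt (R := R) j (ltnSn k').
move: kk'; rewrite neq_ltn => /orP[] h; have := dyad_le (R := R) j h => H;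
  rewrite !inE => /or3P[] /eqP -> /=; [right|right|right|left|left|left]; lra.
Qed.

Lemma step_form_haar n m : step_form (haar_seq n : seq (R * R)) (haar_seq m) = (n == m)%:R.
Proof.
have [->|nm] := eqVneq n m.
  have [->|[j [k [kj ->]]]] := haar_indexP m.
    by rewrite /haar_seq eqxx /step_form !big_seq1/= maxxx subr0 !mulr1.
  rewrite step_form_haar_tail haar_seqE// !big_cons big_nil /= !haar_tailE//.
  (* The tail vanishes at both ends of the cell, so only the midpoint contributes to the norm. *)
  rewrite (@tent_out _ _ _ (dyad j k)); last by rewrite /incell ltxx.
  rewrite (@tent_out _ _ _ (dyad j k.+1)); last by rewrite /incell ltxx andbF.
  rewrite !mulr0 add0r !addr0.
  have := dyad_mid j k; rewrite (dyadS j k) => E.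
  have D : 0 < (2 ^+ j : R) by rewrite exprn_gt0.
  have D' : 0 < (2 ^+ j : R)^-1 by rewrite invr_gt0.
  rewrite tentE ?(dyadS j k); last by apply/andP; split; lra.
  rewrite min_l; last lra.
  rewrite (_ : dyad j.+1 _ = dyad j k + (2 ^+ j)^-1 / 2); last lra.
  transitivity (amp (R := R) j * amp j * (2 ^+ j)^-1); last by rewrite amp2 divff// gt_eqF.
  by move: (2 ^- j) (amp j) (dyad j k) => h a l; field.
have B0 p : p != 0 -> step_form (haar_seq p : seq (R * R)) (haar_seq 0) = 0.
  have [->|[j [k [kj ->]]]] := haar_indexP p; first by rewrite eqxx.
  move=> _; apply: step_form_haar_far => // q; rewrite /haar_seq eqxx inE => /eqP -> /=.
  by left; exact: dyad_ge0.
have [n0|n0] := eqVneq n 0; first by rewrite n0 step_formC B0// -n0 eq_sym.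
have [m0|m0] := eqVneq m 0; first by rewrite m0 B0.
move: nm n0 m0.
have [->|[j [k [kj ->]]]] := haar_indexP n; first by rewrite eqxx.
have [->|[j' [k' [kj' ->]]]] := haar_indexP m; first by rewrite eqxx.
move=> nm _ _; case: (ltngtP j j') => jj'.
- by rewrite step_formC step_form_haar_lt.
- by rewrite step_form_haar_lt.
- by subst j'; rewrite step_form_haar_level//; apply: contra nm => /eqP ->.
Qed.

(* The inner product of the residuals of two Heaviside functions after
   projection onto the first [2 ^ J] Haar functions. *)
Definition resid_kernel J x y : R :=
  1 - Num.max x y - \sum_(0 <= n < 2 ^ J) haar_tail n x * haar_tail n y.

Lemma big_level (V : Type) (idx : V) (op : Monoid.law idx) J (F : nat -> V) :
  \big[op/idx]_(0 <= n < 2 ^ J.+1) F n =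
  op (\big[op/idx]_(0 <= n < 2 ^ J) F n)
     (\big[op/idx]_(0 <= k < 2 ^ J) F (2 ^ J + k)%N).
Proof.
rewrite (@big_cat_nat _ _ _ (2 ^ J)) ?leq_exp2l//=; congr (op _ _).
rewrite -{1}[(2 ^ J)%N]add0n big_addn expnS mul2n -addnn addnK.
by apply: eq_bigr => i _; rewrite addnC.
Qed.

Lemma sum_tent_cell J k x (F : R -> R) : F 0 = 0 -> (k < 2 ^ J)%N ->
  dyad J k <= x <= dyad J k.+1 ->
  \sum_(0 <= i < 2 ^ J) F (haar_tail (2 ^ J + i) x) = F (tent J k x).
Proof.
move=> F0 kJ /andP[xl xr].
rewrite (bigD1_seq k) ?mem_iota ?iota_uniq//= ?subn0 ?add0n//.
rewrite haar_tailE// big1_seq ?addr0// => i /andP[ik]; rewrite mem_iota add0n subn0 => /= iJ.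
rewrite haar_tailE// tent_out ?F0// negb_and -!leNgt.
move: ik; rewrite neq_ltn => /orP[] /(dyad_le (R:=R) J) h;
  first by rewrite (le_trans h xl) orbT.
by rewrite (le_trans xr h).
Qed.

(** The variance of a Brownian bridge on the cell, refined by midpoint displacement: the squared
    tents of level [J] turn the parabola over a cell into one parabola over each half. *)
Lemma resid_kernel_diag J k x : (k < 2 ^ J)%N -> dyad J k <= x <= dyad J k.+1 ->
  resid_kernel J x x = 2 ^+ J * (x - dyad J k) * (dyad J k.+1 - x).
Proof.
elim: J k => [|J IH] k.
  rewrite expn0 ltnS leqn0 => /eqP ->; rewrite /dyad expr0 invr1 !mulr1 => /andP[x0 x1].
  by rewrite /resid_kernel big_nat1 maxxx haar_tail0//; ring.
move=> kJ xk.
have [i kk] : exists i, k = i.*2 \/ k = i.*2.+1.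
  by exists k./2; rewrite -{1 3}(odd_double_half k); case: (odd k); [right|left].
have k2J : (i < 2 ^ J)%N by move: kJ; rewrite expnS; case: kk; lia.
have E := dyad_mid J i.
have lr := dyad_lt (R := R) J (ltnSn i).
have lm := dyad_lt (R := R) J.+1 (ltnSn i.*2).
have mr := dyad_lt (R := R) J.+1 (ltnSn i.*2.+1).
have El := dyad_double (R := R) J i.
have Er := dyad_double (R := R) J i.+1; rewrite doubleS in Er.
have xJ : dyad J i <= x <= dyad J i.+1.
  by move: xk; case: kk => -> /andP[h1 h2]; apply/andP; split; lra.
have -> : resid_kernel J.+1 x x = resid_kernel J x x - \sum_(0 <= n < 2 ^ J) haar_tail (2
  ^ J + n) x * haar_tail (2 ^ J + n) x.
  by rewrite /resid_kernel big_level /=; ring.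
rewrite (IH i)// (@sum_tent_cell _ i _ (fun z => z * z)) ?mulr0//.
rewrite tentE// mulrNN mulrACA amp2 exprS.
move: (2 ^+ J) => D.
set l := dyad J _ in E lr El xJ *; set r := dyad J _ in E lr Er xJ *.
set m := dyad J.+1 _ in E lm mr.
case: kk => kk.
- have e1 : dyad J.+1 k = l by rewrite kk El.
  have e2 : dyad J.+1 k.+1 = m by rewrite kk.
  move: xk; rewrite e1 e2 => /andP[h1 h2].
  rewrite min_l; last lra.
  rewrite (_ : r = 2 * m - l); last lra.
  by ring.
- have e1 : dyad J.+1 k = m by rewrite kk.
  have e2 : dyad J.+1 k.+1 = r by rewrite kk Er.
  move: xk; rewrite e1 e2 => /andP[h1 h2].
  rewrite min_r; last lra.
  rewrite (_ : r = 2 * m - l); last lra.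
  by ring.
Qed.

Lemma dyad_cell J x : 0 <= x <= 1 ->
  exists2 k, (k < 2 ^ J)%N & dyad J k <= x <= dyad J k.+1.
Proof.
move=> /andP[x0 x1]; have D : 0 < (2 ^+ J : R) by rewrite exprn_gt0.
have [xlt|xge] := ltP x 1; last first.
  have -> : x = 1 by apply/eqP; rewrite eq_le x1 xge.
  exists (2 ^ J).-1; first by rewrite prednK// expn_gt0.
  by rewrite prednK ?expn_gt0// dyad1 lexx andbT dyad_le1// leq_pred.
have y0 : 0 <= x * 2 ^+ J by rewrite mulr_ge0// ltW.
have /andP[h1 h2] := truncn_itv y0.
exists (Num.truncn (x * 2 ^+ J)).
  rewrite -(ltr_nat R) natrX (le_lt_trans h1)//.
  by rewrite -[ltRHS]mul1r ltr_pM2r.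
by rewrite /dyad ler_pdivrMr// ler_pdivlMr// h1 (ltW h2).
Qed.

Lemma resid_kernel_le J x : 0 <= x <= 1 -> resid_kernel J x x <= (2 ^+ J)^-1.
Proof.
move=> /(dyad_cell J)[k kJ xk]; rewrite (resid_kernel_diag kJ xk).
have D : 0 < (2 ^+ J : R) by rewrite exprn_gt0.
case/andP: xk; rewrite dyadS => h1 h2.
set l := dyad J k in h1 h2 *; set h := (2 ^+ J)^-1 in h2 *.
have Dh : 2 ^+ J * h = 1 by rewrite /h divff// gt_eqF.
have h0 : 0 <= h by rewrite /h invr_ge0 ltW.
have H : (x - l) * (l + h - x) <= h * h by apply: ler_pM; lra.
rewrite -mulrA; apply: le_trans (ler_wpM2l (ltW D) H) _.
by rewrite mulrA Dh mul1r.
Qed.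

End ortho.

(** * Partial Haar sums and the greedy error *)

Section partial_sums.
Context {R : realType}.
Local Notation mu := (@lebesgue_measure R).
Implicit Types (s u : seq (R * R)) (x y t : R) (j k n : nat).

Lemma measurable_haar n D : measurable_fun D (haar n : R -> R).
Proof.
apply: measurable_funS (@measurableT _ _) (@subsetT _ _) _.
rewrite /haar; case: ifP => _; first exact: measurable_indic.
apply: measurable_funM => //; apply: measurableT_comp => //.
  by apply: measurable_funB; exact: measurable_indic.
by apply: measurable_funB => //; exact: measurable_funM.
Qed.

Definition residual u (G : seq nat) : seq (R * R) :=
  u ++ flatten [seq scale (- step_form u (haar_seq n)) (haar_seq n) | n <- G].

Lemma residual_in01 u G : in01 u -> in01 (residual u G).
Proof.
move=> u01; rewrite /in01 all_cat -/(in01 u) u01/=.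
apply/allP => p /flattenP[s /mapP[n _ ->]] /mapP[q qn ->] /=.
exact: (allP (in01_haar_seq n) _ qn).
Qed.

Lemma step_form_residual_haar u G m : uniq G ->
  step_form (residual u G) (haar_seq m) = if m \in G then 0 else step_form u (haar_seq m).
Proof.
move=> uG; rewrite step_form_catl step_form_flattenl.
under eq_bigr do rewrite step_form_scalel step_form_haar.
case: ifPn => mG.
  rewrite (bigD1_seq m)//= eqxx mulr1 big1 ?addr0 ?subrr// => n nm.
  by rewrite (negbTE nm) mulr0.
rewrite big1_seq ?addr0// => n /= nG; case: eqP => [nm|]; rewrite ?mulr0//.
by rewrite nm (negbTE mG) in nG.
Qed.

(** Pythagoras: the residual is orthogonal to every Haar function listed in [G]. *)
Lemma step_form_residual u G : uniq G ->
  step_form (residual u G) (residual u G) =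
  step_form u u - \sum_(n <- G) step_form u (haar_seq n) ^+ 2.
Proof.
move=> uG; rewrite {2}/residual step_form_catr (step_formC (residual u G) (flatten _)).
rewrite step_form_flattenl big1_seq ?addr0; last first.
  by move=> n /= nG; rewrite step_form_scalel (step_formC (haar_seq n) (residual u G))
    step_form_residual_haar// nG mulr0.
rewrite step_form_catl step_form_flattenl -sumrN; congr (_ + _).
by apply: eq_bigr => n _; rewrite step_form_scalel (step_formC (haar_seq n)) mulNr expr2.
Qed.

Lemma bessel u G : in01 u -> uniq G ->
  \sum_(n <- G) step_form u (haar_seq n) ^+ 2 <= step_form u u.
Proof.
by move=> u01 uG; rewrite -subr_ge0 -step_form_residual// step_form_ge0// residual_in01.
Qed.

(** Serves to replace [haar n] by [step (haar_seq n)] under the integral; [s] will be the list of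
    breakpoints. *)
Lemma ae_eq01 (s : seq R) (g h : R -> R) :
  measurable_fun setT g -> measurable_fun setT h ->
  (forall t, 0 <= t <= 1 -> t \notin s -> g t = h t) ->
  (\int[mu]_(t in `[0%R, 1%R]) (g t)%:E = \int[mu]_(t in `[0%R, 1%R]) (h t)%:E)%E.
Proof.
move=> mg mh gh; apply: ae_eq_integral => //; [exact/measurable_EFinP/measurable_funTS..|].
exists [set` s]; split.
- apply: countable_measurable; last exact/finite_set_countable/finite_seq.
  by move=> t; exact: measurable_set1.
- by apply: countable_lebesgue_measure0; exact/finite_set_countable/finite_seq.
- move=> t /= /not_implyP[]; rewrite in_itv /= => t01 ne.
  by apply: contrapT => /negP ts; apply: ne; rewrite gh.
Qed.

(** Among M + 1 retained indices the largest would have M nonzero coefficients before it. Finiteness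
    turns the sum defining [greedy_approx] into an ordinary finite sum. *)
Lemma finite_greedy_indices M (f : R -> R) : finite_set (greedy_indices M f).
Proof.
apply: contrapT => /(@infinite_set_fset _ _ M.+1)[B BG MB].
have [m mB mmax] : exists2 m, m \in B & forall n, n \in B -> (n <= m)%N.
  have : B != fset0 by rewrite -cardfs_gt0 (leq_ltn_trans _ MB).
  move=> /fset0Pn[b0 b0B].
  have [m mB mmax] := @arg_maxnP B [` b0B]%fset predT val isT.
  exists (val m); first exact: valP.
  by move=> n nB; exact: (mmax [` nB]%fset isT).
have [_] := BG _ mB; apply/negP; rewrite -leqNgt -size_filter.
have: (size (rem m B) <= size [seq x <- iota 0 m | haar_coef f x != 0%R])%N.
  apply: uniq_leq_size; first by rewrite rem_uniq.
  move=> n; rewrite mem_rem_uniq ?fset_uniq// inE => /andP[nm nB].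
  have [cn _] := BG _ nB.
  by rewrite mem_filter cn mem_iota add0n/= ltn_neqAle nm mmax.
by rewrite size_rem//; apply: leq_trans; rewrite -ltnS prednK// (leq_trans _ MB).
Qed.

Section step_function.
Variables (f : R -> R) (u : seq (R * R)).
Hypotheses (u01 : in01 u) (fu : forall t, 0 <= t <= 1 -> f t = step u t).

Lemma haar_coef_step n : haar_coef f n = step_form u (haar_seq n).
Proof.
rewrite /haar_coef /Rintegral -[RHS]/(fine (step_form u (haar_seq n))%:E); congr fine.
rewrite -integral_step2 ?in01_haar_seq//.
transitivity (\int[mu]_(t in `[0%R, 1%R]) (step u t * haar n t)%:E)%E.
  apply: eq_integral => t; by rewrite inE/= in_itv/= => t01; rewrite fu.
apply: (@ae_eq01 [seq p.2 | p <- haar_seq n]).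
- by apply: measurable_funM; [exact: measurable_step|exact: measurable_haar].
- by apply: measurable_funM; exact: measurable_step.
- by move=> t t01 ts; rewrite haar_stepE.
Qed.

Lemma sq_L2_norm01_residual (G : seq nat) : uniq G ->
  sq_L2_norm01 (fun x => f x - \sum_(n <- G) step_form u (haar_seq n) * haar n x) =
  (step_form u u - \sum_(n <- G) step_form u (haar_seq n) ^+ 2)%:E.
Proof.
move=> uG; rewrite /sq_L2_norm01 -step_form_residual//.
rewrite -integral_step2 ?residual_in01//.
transitivity (\int[mu]_(t in `[0%R, 1%R])
    ((step u t - \sum_(n <- G) step_form u (haar_seq n) * haar n t) ^+ 2)%:E)%E.
  apply: eq_integral => t; by rewrite inE/= in_itv/= => t01; rewrite fu.
apply: (@ae_eq01 (flatten [seq [seq p.2 | p <- haar_seq n] | n <- G])).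
- apply: measurable_funX; apply: measurable_funB; first exact: measurable_step.
  by apply: measurable_sum => n; apply: measurable_funM => //; exact: measurable_haar.
- by apply: measurable_funM; exact: measurable_step.
move=> t t01 ts; rewrite -expr2; congr (_ ^+ 2).
rewrite step_cat step_flatten -sumrN; congr (_ + _).
rewrite big_seq [RHS]big_seq; apply: eq_bigr => n nG.
rewrite step_scale mulNr haar_stepE//; apply: contra ts => tn.
by apply/flattenP; exists [seq p.2 | p <- haar_seq n] => //; exact: map_f.
Qed.

Lemma sq_L2_norm01_greedy M :
  sq_L2_norm01 (fun x => f x - greedy_approx M f x) =
  (step_form u u - \sum_(n <- fset_set (greedy_indices M f)) step_form u (haar_seq n) ^+ 2)%:E.
Proof.
rewrite -sq_L2_norm01_residual ?fset_uniq//; congr sq_L2_norm01.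
apply/funext => x; congr (_ - _); rewrite /greedy_approx fsbig_finite//=.
  by apply: eq_bigr => n _; rewrite haar_coef_step.
exact: finite_greedy_indices.
Qed.

Lemma mem_greedy M n : (n \in fset_set (greedy_indices M f)) =
  (step_form u (haar_seq n) != 0) &&
  (count (fun m => step_form u (haar_seq m) != 0%R) (iota 0 n) < M)%N.
Proof.
rewrite in_fset_set; last exact: finite_greedy_indices.
apply/idP/idP; rewrite inE /greedy_indices /= haar_coef_step.
  by move=> [-> /=]; congr (_ < _)%N; apply: eq_count => m; rewrite haar_coef_step.
move=> /andP[-> h]; split => //; move: h; congr (_ < _)%N.
by apply: eq_count => m; rewrite haar_coef_step.
Qed.

(** All nonzero coefficients below 2^J are retained, and any further retained one only lowers the
    error. *)
Lemma greedy_err_le M J :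
  (count (fun m => step_form u (haar_seq m) != 0%R) (iota 0 (2 ^ J)) <= M)%N ->
  (sq_L2_norm01 (fun x => (f x - greedy_approx M f x)%R) <=
    (step_form u u - \sum_(0 <= n < 2 ^ J) step_form u (haar_seq n) ^+ 2)%R%:E)%E.
Proof.
move=> cM; rewrite sq_L2_norm01_greedy lee_fin lerB//.
rewrite [leRHS](bigID (fun n => n < 2 ^ J)%N)/= -[leLHS]addr0.
apply: lerD; last by apply: sumr_ge0 => n _; exact: sqr_ge0.
rewrite -[leRHS]big_filter [leLHS](bigID (fun n => step_form u (haar_seq n) != 0))/=.
rewrite [X in _ + X]big1 ?addr0; last first.
  by move=> n; rewrite negbK => /eqP ->; rewrite expr0n.
rewrite -[leLHS]big_filter le_eqVlt; apply/orP; left; apply/eqP.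
apply: perm_big; apply: uniq_perm; rewrite ?filter_uniq ?iota_uniq ?fset_uniq//.
move=> n; rewrite !mem_filter mem_greedy mem_index_iota leq0n /=.
case: (boolP (step_form _ _ != 0)) => n0 /=; rewrite ?andbF//.
case: (ltnP n (2 ^ J)) => //= nJ; apply/esym.
apply: leq_trans cM.
(* The coefficient [n] is itself among those counted below 2^J, whence the strict inequality. *)
rewrite -(subnKC nJ) iotaD count_cat -addn1 -[n.+1]addn1 iotaD count_cat /= n0.
by rewrite addn0 leq_addr.
Qed.

(** The budget [M] is spent before level [J], so nothing of that level is retained. Bessel over the
    first 2^(J+1) functions then leaves at least the energy of level [J]. *)
Lemma greedy_err_ge M J :
  (M <= count (fun m => step_form u (haar_seq m) != 0%R) (iota 0 (2 ^ J)))%N ->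
  ((\sum_(0 <= k < 2 ^ J) step_form u (haar_seq (2 ^ J + k)) ^+ 2)%R%:E <=
   sq_L2_norm01 (fun x => (f x - greedy_approx M f x)%R))%E.
Proof.
move=> cM; rewrite sq_L2_norm01_greedy lee_fin lerBrDr.
apply: le_trans (bessel u01 (iota_uniq 0 (2 ^ J.+1 - 0))).
rewrite -/(index_iota 0 (2 ^ J.+1)) big_level /= addrC lerD2l.
rewrite [leRHS](bigID (fun n => n \in fset_set (greedy_indices M f)))/= -[leLHS]addr0.
apply: lerD; last by apply: sumr_ge0 => n _; exact: sqr_ge0.
rewrite -[leRHS]big_filter le_eqVlt; apply/orP; left; apply/eqP.
apply: perm_big; apply: uniq_perm; rewrite ?filter_uniq ?iota_uniq ?fset_uniq//.
move=> n; rewrite mem_filter mem_greedy mem_index_iota leq0n /=.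
case: (ltnP n (2 ^ J)) => nJ; rewrite ?andbT ?andbF//.
apply/negbTE; rewrite negb_and -leqNgt (leq_trans cM) ?orbT//.
by rewrite -(subnKC nJ) iotaD count_cat leq_addr.
Qed.

End step_function.
End partial_sums.

(** * Nonzero Haar coefficients *)

Section counting.
Context {R : realType}.
Implicit Types (s u : seq (R * R)) (x y t : R) (j k n : nat).

Definition coef_neq0 u : pred nat := fun n => step_form u (haar_seq n) != 0.

Definition ncell j k u := count (fun p => incell j k p.2) u.

Lemma coef_level j k u : (k < 2 ^ j)%N ->
  step_form u (haar_seq (2 ^ j + k)) = \sum_(p <- u) p.1 * tent j k p.2.
Proof. by move=> kj; rewrite step_form_haar_tail; apply: eq_bigr => p _;
  rewrite haar_tailE. Qed.

Lemma coef_neq0_le_ncell j k u : (k < 2 ^ j)%N ->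
  (coef_neq0 u (2 ^ j + k) <= ncell j k u)%N.
Proof.
move=> kj; rewrite /coef_neq0 coef_level//; case: (boolP (_ != 0)) => //= h.
rewrite -has_count; apply: contraNT h => /hasPn h.
by rewrite big1_seq// => p /= /h /tent_out ->; rewrite mulr0.
Qed.

Lemma sum_ncell j u :
  (\sum_(0 <= k < 2 ^ j) ncell j k u =
   \sum_(p <- u) \sum_(0 <= k < 2 ^ j) incell j k p.2)%N.
Proof.
rewrite exchange_big; apply: eq_bigr => k _.
rewrite /ncell -sum1_count [LHS]big_mkcond /=.
by apply: eq_bigr => p _; case: (incell j k p.2).
Qed.

Lemma sum_incell_le1 j x : 0 <= x <= 1 ->
  (\sum_(0 <= k < 2 ^ j) incell j k x <= 1)%N.
Proof.
move=> /(dyad_cell j)[k kj /andP[xl xr]].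
rewrite (bigD1_seq k) ?mem_iota ?iota_uniq//= ?subn0 ?add0n//.
rewrite big1_seq ?addn0 ?leq_b1// => i /andP[ik _]; apply/eqP; rewrite eqb0.
rewrite negb_and -!leNgt; move: ik; rewrite neq_ltn.
move=> /orP[] /(dyad_le (R := R) j) h; first by rewrite (le_trans h xl) orbT.
by rewrite (le_trans xr h).
Qed.

Lemma sum_incell_eq1 j x : 0 <= x <= 1 -> (forall k, x != dyad j k) ->
  (\sum_(0 <= k < 2 ^ j) incell j k x = 1)%N.
Proof.
move=> x01 nd; apply/eqP; rewrite eqn_leq sum_incell_le1//=.
have [k kj /andP[xl xr]] := dyad_cell j x01.
rewrite (bigD1_seq k) ?mem_iota ?iota_uniq//= ?subn0 ?add0n//.
by rewrite /incell !lt_neqAle xl xr eq_sym !nd.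
Qed.

Lemma count_level u J : count (coef_neq0 u) (iota 0 (2 ^ J.+1)) =
  (count (coef_neq0 u) (iota 0 (2 ^ J)) +
   \sum_(0 <= k < 2 ^ J) coef_neq0 u (2 ^ J + k))%N.
Proof.
have E m : count (coef_neq0 u) (iota 0 m) = (\sum_(0 <= n < m) coef_neq0 u n)%N.
  rewrite -[LHS]sum1_count [LHS]big_mkcond /index_iota subn0 /=.
  by apply: eq_bigr => n _; case: (coef_neq0 u n).
by rewrite !E big_level.
Qed.

(** The 1 stands for the index 0, the levels starting at index 1; it is the source of the M - 1 in
    the upper bound. *)
Lemma count_coef_le u J : in01 u ->
  (count (coef_neq0 u) (iota 0 (2 ^ J)) <= 1 + size u * J)%N.
Proof.
move=> u01; elim: J => [|J IH]; first by rewrite muln0 /= addn0 leq_b1.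
rewrite count_level mulnS addnCA addnC leq_add//.
apply: (@leq_trans (\sum_(0 <= k < 2 ^ J) ncell J k u)).
  rewrite big_seq [leqRHS]big_seq; apply: leq_sum => k.
  by rewrite mem_index_iota => kJ; exact: coef_neq0_le_ncell.
rewrite sum_ncell -sum1_size big_seq [leqRHS]big_seq; apply: leq_sum => p pu.
exact: sum_incell_le1 (allP u01 _ pu).
Qed.

(** With a single jump in the cell there is nothing to cancel: the cross terms vanish on the path
    itself, not just in expectation. *)
Lemma coef_single j k u : (k < 2 ^ j)%N -> (ncell j k u <= 1)%N ->
  step_form u (haar_seq (2 ^ j + k)) ^+ 2 = \sum_(p <- u) (p.1 * tent j k p.2) ^+ 2.
Proof.
move=> kj; rewrite coef_level//; elim: u => [|p u IH] n1.
  by rewrite !big_nil expr0n.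
rewrite !big_cons; have [pc|pc] := boolP (incell j k p.2); last first.
  by rewrite tent_out// mulr0 !add0r expr0n add0r IH//; move: n1; rewrite /ncell/= (negbTE pc).
move: n1; rewrite /ncell/= pc ltnS leqn0 -leqn0 leqNgt -has_count => /hasPn h.
rewrite !big1_seq ?addr0// => q /= /h /tent_out ->; rewrite mulr0//.
by rewrite expr0n.
Qed.

Lemma ncell_le_coef_neq0 j k u : (k < 2 ^ j)%N -> (ncell j k u <= 1)%N ->
  (forall p, p \in u -> p.1 != 0) -> (ncell j k u <= coef_neq0 u (2 ^ j + k))%N.
Proof.
move=> kj n1 u0; case: (posnP (ncell j k u)) => [->//|n0].
apply: (leq_trans n1); rewrite lt0b /coef_neq0.
rewrite -sqrf_eq0 coef_single//; move: n0; rewrite -has_count => /hasP[p pu pc].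
rewrite psumr_eq0; last by move=> q _; exact: sqr_ge0.
apply/allPn; exists p => //=.
by rewrite sqrf_eq0 mulf_neq0 ?u0// tent_neq0.
Qed.

Lemma ncell_refine j i k u :
  (ncell (j + i) k u <= ncell j (k %/ 2 ^ i) u)%N.
Proof.
apply: sub_count => p /andP[/= h1 h2]; apply/andP; split.
  by apply: le_lt_trans h1; rewrite -(dyad_mulX i) dyad_le// leq_trunc_div.
apply: lt_le_trans h2 _; rewrite -(dyad_mulX i j) dyad_le// ltn_ceil//.
by rewrite expn_gt0.
Qed.

(** Jumps separated at level [j] stay separated at all finer levels. A time that is never dyadic
    lies in an open cell of each level and a nonzero height gives a nonzero coefficient, so each of
    the [q] levels from [j] on contributes [size u]. *)
Lemma count_coef_ge u j q : in01 u ->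
  (forall k, (k < 2 ^ j)%N -> (ncell j k u <= 1)%N) ->
  (forall p, p \in u -> p.1 != 0 /\ forall j k, p.2 != dyad j k) ->
  (size u * q <= count (coef_neq0 u) (iota 0 (2 ^ (j + q))))%N.
Proof.
move=> u01 sep un; elim: q => [|q IH]; first by rewrite muln0.
rewrite addnS count_level mulnSr leq_add//.
apply: (@leq_trans (\sum_(0 <= k < 2 ^ (j + q)) ncell (j + q) k u)).
  rewrite sum_ncell -sum1_size big_seq [leqRHS]big_seq; apply: leq_sum => p pu.
  rewrite sum_incell_eq1 ?(allP u01 _ pu)//.
  by have [_ + k] := un _ pu; apply.
rewrite big_seq [leqRHS]big_seq; apply: leq_sum => k.
rewrite mem_index_iota => /= kJ; apply: ncell_le_coef_neq0 => //.
  apply: leq_trans (ncell_refine _ _ _ _) (sep _ _).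
  by rewrite ltn_divLR ?expn_gt0// -expnD.
by move=> p /un[].
Qed.

Lemma step_form_resid_kernel u J : step_form u u - \sum_(0 <= n < 2 ^ J) step_form u
  (haar_seq n) ^+ 2 =
  \sum_(p <- u) \sum_(q <- u) p.1 * q.1 * resid_kernel J p.2 q.2.
Proof.
rewrite /resid_kernel; under [RHS]eq_bigr do under eq_bigr do rewrite mulrBr.
under [RHS]eq_bigr do rewrite big_split/= sumrN.
rewrite big_split/= -/(step_form u u); congr (_ + _); rewrite sumrN; congr (- _).
under [RHS]eq_bigr do under eq_bigr do rewrite mulr_sumr.
under [RHS]eq_bigr do rewrite exchange_big.
rewrite exchange_big; apply: eq_bigr => n _.
rewrite step_form_haar_tail expr2 mulr_suml; apply: eq_bigr => p _.
by rewrite mulr_sumr; apply: eq_bigr => q _; ring.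
Qed.

(** On the middle half of the cell the distance to its ends is at least a quarter of its length, so
    the square is at least 2^J (2^-J / 4)^2. *)
Lemma tent_mid J k x : dyad J.+2 (4 * k + 1) <= x <= dyad J.+2 (4 * k + 3) ->
  (16 * 2 ^+ J)^-1 <= tent J k x ^+ 2.
Proof.
have D : 0 < (2 ^+ J : R) by rewrite exprn_gt0.
have e i : dyad J.+2 (4 * k + i) = dyad J k + i%:R * (2 ^+ J)^-1 / 4 :> R.
  by rewrite /dyad natrD natrM 2!exprS; field; rewrite gt_eqF.
rewrite !e => /andP[h1 h2]; rewrite tentE ?dyadS.
  rewrite sqrrN exprMn expr2 amp2.
  have : (2 ^+ J)^-1 / 4 <= Num.min (x - dyad J k) (dyad J k + (2 ^+ J)^-1 - x).
    by rewrite le_min; apply/andP; split; lra.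
  set h := (2 ^+ J)^-1 in h1 h2 * => H.
  have h0 : 0 < h by rewrite invr_gt0.
  have : (h / 4) ^+ 2 <= Num.min (x - dyad J k) (dyad J k + h - x) ^+ 2.
    by rewrite lerXn2r// nnegrE; [apply: divr_ge0 => //; exact: ltW|apply: le_trans H;
      apply: divr_ge0 => //; exact: ltW].
  move=> /(ler_wpM2l (ltW D)); apply: le_trans.
  rewrite /h le_eqVlt; apply/orP; left; apply/eqP; field; rewrite gt_eqF//.
have h0 : 0 < (2 ^+ J : R)^-1 by rewrite invr_gt0.
by apply/andP; split; lra.
Qed.

Section step_function.
Variables (f : R -> R) (u : seq (R * R)).
Hypotheses (u01 : in01 u) (fu : forall t, 0 <= t <= 1 -> f t = step u t).

Lemma greedy_err_le_resid_kernel M J : (1 + size u * J <= M)%N ->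
  (sq_L2_norm01 (fun x => (f x - greedy_approx M f x)%R) <=
   (\sum_(p <- u) \sum_(q <- u) p.1 * q.1 * resid_kernel J p.2 q.2)%R%:E)%E.
Proof.
move=> h; rewrite -step_form_resid_kernel; apply: greedy_err_le => //.
exact: leq_trans (count_coef_le J u01) h.
Qed.

Lemma greedy_err_tent_ge M j q : (M <= size u * q)%N ->
  (forall k, (k < 2 ^ j)%N -> (ncell j k u <= 1)%N) ->
  (forall p, p \in u -> p.1 != 0 /\ forall j k, p.2 != dyad j k) ->
  ((\sum_(0 <= k < 2 ^ (j + q)) \sum_(p <- u) (p.1 * tent (j + q) k p.2) ^+ 2)%R%:E <=
    sq_L2_norm01 (fun x => (f x - greedy_approx M f x)%R))%E.
Proof.
move=> h sep un; have := @greedy_err_ge _ _ _ u01 fu M (j + q) (leq_trans h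
  (count_coef_ge q u01 sep un)).
apply: le_trans.
rewrite lee_fin le_eqVlt; apply/orP; left; apply/eqP.
rewrite big_seq [RHS]big_seq; apply: eq_bigr => k; rewrite mem_index_iota => /= kJ.
rewrite coef_single//; apply: leq_trans (ncell_refine _ _ _ _) (sep _ _).
by rewrite ltn_divLR ?expn_gt0// -expnD.
Qed.

End step_function.
End counting.

(** * Measure theory *)

(* The squared error is never shown to be measurable, so only one of the two
   integrands is assumed to be. *)
Section integral_facts.
Context d (T : measurableType d) (R : realType) (mu : {measure set T -> \bar R}).
Local Open Scope ereal_scope.
Implicit Types f g : T -> \bar R.

Import HBNNSimple.

(** Monotonicity without measurability: the integral of a nonnegative function is a supremum over
    the simple functions below it. *)
Lemma le_integral_pointwise f g : (forall x, 0 <= f x) -> (forall x, f x <= g x) ->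
  \int[mu]_x f x <= \int[mu]_x g x.
Proof.
move=> f0 fg; have g0 x : 0 <= g x by exact: le_trans (f0 x) (fg x).
rewrite !ge0_integralTE//; apply: ereal_sup_le => _ [h hf <-].
by exists h => // x; exact: le_trans (hf x) (fg x).
Qed.

Lemma measurable_fun_mem (N : set T) : measurable N ->
  measurable_fun setT (fun x => x \in N).
Proof.
move=> mN; apply: (@measurable_fun_bool _ _ _ _ true); rewrite setTI.
rewrite (_ : _ @^-1` _ = N)//; apply/seteqP; split => x /=; last by move=> /mem_set.
exact: set_mem.
Qed.

Lemma le_integral_measurable_r (N : set T) f g : measurable N -> mu N = 0 ->
  (forall x, 0 <= f x) -> (forall x, 0 <= g x) -> measurable_fun setT g ->
  (forall x, ~ N x -> f x <= g x) -> \int[mu]_x f x <= \int[mu]_x g x.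
Proof.
move=> mN N0 f0 g0 mg fg.
(* Raising [g] to infinity on the null set makes the comparison hold everywhere at no cost in the
   integral; only [g] has to be measurable for this. *)
pose g' x := if x \in N then +oo else g x.
have mg' : measurable_fun setT g'.
  apply: measurable_fun_if => //; last exact: measurable_funTS.
  exact: measurable_fun_mem.
have g'0 x : 0 <= g' x by rewrite /g'; case: ifP.
rewrite (@ge0_ae_eq_integral _ _ _ mu setT g g')//; last first.
  exists N; split => // x /= /not_implyP[_]; rewrite /g'; case: ifPn => // xN _.
  by rewrite inE in xN.
apply: le_integral_pointwise => // x; rewrite /g'; case: ifPn => [_|xN]; first exact: leey.
by apply: fg; rewrite notin_setE in xN.
Qed.

Lemma le_integral_measurable_l (N : set T) f g : measurable N -> mu N = 0 ->
  (forall x, 0 <= f x) -> (forall x, 0 <= g x) -> measurable_fun setT f ->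
  (forall x, ~ N x -> f x <= g x) -> \int[mu]_x f x <= \int[mu]_x g x.
Proof.
move=> mN N0 f0 g0 mf fg.
(* Dually, the measurable smaller function is lowered to 0 on the null set. *)
pose f' x := if x \in N then 0 else f x.
have mf' : measurable_fun setT f'.
  apply: measurable_fun_if => //; last exact: measurable_funTS.
  exact: measurable_fun_mem.
have f'0 x : 0 <= f' x by rewrite /f'; case: ifP.
rewrite (@ge0_ae_eq_integral _ _ _ mu setT f f')//; last first.
  exists N; split => // x /= /not_implyP[_]; rewrite /f'; case: ifPn => // xN _.
  by rewrite inE in xN.
apply: le_integral_pointwise => // x; rewrite /f'; case: ifPn => [_//|xN].
by apply: fg; rewrite notin_setE in xN.
Qed.

End integral_facts.

Section product_law.
Context d (T : measurableType d) (R : realType) (P : probability T R).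
Local Open Scope ereal_scope.
Variables X Y : {RV P >-> R}.
Hypothesis XY : forall A B : set R, measurable A -> measurable B ->
  P (X @^-1` A `&` Y @^-1` B) = P (X @^-1` A) * P (Y @^-1` B).

Let mXY : measurable_fun setT (fun w => (X w, Y w)).
Proof. exact: measurable_fun_pair. Qed.

(** By independence the joint law agrees with the product law on rectangles, hence everywhere. *)
Lemma law_pair (f : R * R -> \bar R) :
  \int[distribution P X \x distribution P Y]_z f z =
  \int[distribution P (mfun_Sub (mem_set mXY))]_z f z.
Proof.
apply: eq_measure_integral => A mA _.
by apply: product_measure_unique => // B C mB mC; exact: XY.
Qed.

Lemma integral_mul_indep :
  P.-integrable setT (EFin \o X) -> P.-integrable setT (EFin \o Y) ->
  P.-integrable setT (fun w => (X w * Y w)%:E) /\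
  \int[P]_w (X w * Y w)%:E = \int[P]_w (X w)%:E * \int[P]_w (Y w)%:E.
Proof.
move=> iX iY.
have mM : measurable_fun setT (fun z : R * R => (z.1 * z.2)%:E).
  by apply/measurable_EFinP; apply: measurable_funM.
have iX' : (distribution P X).-integrable setT (@EFin R).
  by apply: integrable_pushforward => //; rewrite preimage_setT.
have iY' : (distribution P Y).-integrable setT (@EFin R).
  by apply: integrable_pushforward => //; rewrite preimage_setT.
have iM : (distribution P X \x distribution P Y).-integrable setT
    (fun z : R * R => (z.1 * z.2)%:E).
  apply/integrableP; split => //.
  have mabs : measurable_fun setT (abse \o (fun z : R * R => (z.1 * z.2)%:E)).
    exact: measurableT_comp.
  rewrite fubini_tonelli1//= /fubini_F /=.
  have mn : measurable_fun setT (fun y : R => `|y|%:E).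
    by apply/measurable_EFinP; exact: normr_measurable.
  under eq_integral => x _.
    under eq_integral do rewrite normrM EFinM.
    rewrite ge0_integralZl//.
    over.
  rewrite ge0_integralZr//; last exact: integral_ge0.
  have /integrableP[_ hX] := iX'; have /integrableP[_ hY] := iY'.
  by apply: lte_mul_pinfty => //; [exact: integral_ge0|rewrite ge0_fin_numE//;
    exact: integral_ge0].
have iMP : (distribution P (mfun_Sub (mem_set mXY))).-integrable setT
    (fun z : R * R => (z.1 * z.2)%:E).
  apply/integrableP; split => //; rewrite -law_pair.
  by case/integrableP : iM.
have iXY : P.-integrable setT (fun w => (X w * Y w)%:E).
  apply/integrableP; split; first by apply/measurable_EFinP; exact: measurable_funM.
  case/integrableP : iMP => _; rewrite ge0_integral_distribution//.
  exact: measurableT_comp.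
split => //.
transitivity (\int[distribution P (mfun_Sub (mem_set mXY))]_z (z.1 * z.2)%:E).
  by rewrite integral_distribution.
rewrite -law_pair -integral12_prod_meas1// /fubini_F /=.
under eq_integral => x _.
  under eq_integral do rewrite EFinM.
  rewrite integralZl//.
  over.
have fY : \int[distribution P Y]_y y%:E \is a fin_num by exact: integrable_fin_num.
rewrite -(fineK fY) integralZr//= fineK//.
by rewrite !integral_distribution//.
Qed.

End product_law.

Section sigma_family.
Context d d' (T : measurableType d) (T' : measurableType d') (I : Type).
Variable X : I -> T -> T'.

(** [T] under the sigma-algebra generated by the family. A functional of the jump times alone is a
    function measurable from this type, so the usual measurability lemmas apply to it. *)
Definition sigma_family_type :=
  g_sigma_algebraType (\bigcup_i preimage_set_system setT (X i) measurable).

Lemma measurable_sigma_family i :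
  measurable_fun setT (X i : sigma_family_type -> T').
Proof.
move=> _ B mB; apply: sub_sigma_algebra; exists i => //.
by exists B.
Qed.

Lemma sigma_family_sub (A : set T) : (forall i, measurable_fun setT (X i)) ->
  sigma_of_family X A -> measurable A.
Proof.
move=> mX; apply: smallest_sub; first exact: sigma_algebra_measurable.
by move=> B [i _ [C mC <-]]; exact: mX.
Qed.

End sigma_family.

Section point_count_measurable.
Context d (T : measurableType d) (R : realType) (X : nat -> T -> R).
Hypothesis mX : forall k, measurable_fun setT (X k).

Lemma point_countE (A : set R) w :
  point_count X A w = (\sum_(k <oo) (\1_A (X k w))%:E)%E.
Proof.
rewrite /point_count counting_dirac; apply: eq_eseriesr => k _.
by rewrite /dirac indicE; congr (_%:R%:E); apply/idP/idP; rewrite !inE.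
Qed.

Lemma measurable_point_count (A : set R) : measurable A ->
  measurable_fun setT (point_count X A).
Proof.
move=> mA; rewrite (_ : point_count X A = fun w => (\sum_(k <oo) (\1_A (X k w))%:E)%E).
  apply: ge0_emeasurable_sum => // k _ ; apply/measurable_EFinP.
  by apply: measurableT_comp => //; exact: measurable_indic.
by apply/funext => w; rewrite point_countE.
Qed.

Lemma measurable_point_count_eq (A : set R) (n : nat) : measurable A ->
  measurable [set w | point_count X A w = n%:R%:E].
Proof.
move=> mA; have := measurable_point_count mA measurableT (emeasurable_set1 n%:R%:E).
by rewrite setTI.
Qed.

Lemma measurable_occupied (A : set R) (S : set nat) : measurable A ->
  measurable [set w | [set k | A (X k w)] = S].
Proof.
move=> mA.
rewrite (_ : mkset _ = \bigcap_k (X k @^-1` (if k \in S then A else ~` A))).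
  apply: bigcapT_measurable => k; rewrite -[X in measurable X]setTI.
  by apply: mX => //; case: ifP => // _; exact: measurableC.
apply/seteqP; split => w /=.
  by move=> <- k _ /=; case: ifPn => [/set_mem|/negP kS]//= ?; apply: kS; exact: mem_set.
move=> h; apply/seteqP; split => k /=; have := h k I; case: ifPn => /= kS //.
- by move=> _ _; exact: set_mem.
- by move=> _ Sk; rewrite mem_set in kS.
Qed.

End point_count_measurable.

(** * Moments of the jump heights *)

Section jumps.
Context (R : realType) (Pa : probability R R) d (T : measurableType d)
  (P : probability T R) (tau a : nat -> {RV P >-> R}).
Local Open Scope ereal_scope.
Hypothesis a_iid : iid_with_law Pa a.
Hypothesis a_tau : independent_families P (fun k => a k : T -> R) (fun k => tau k : T -> R).
Hypothesis Pa_mean : \int[Pa]_x x%:E = 0.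
Hypothesis Pa_sq : Pa.-integrable setT (fun x => (x ^+ 2)%:E).

Let sigma2 : R := fine (\int[Pa]_x (x ^+ 2)%:E).
Local Notation tauT := (sigma_family_type (fun k => tau k : T -> R)).

Lemma law_jump k (f : R -> \bar R) :
  \int[distribution P (a k)]_x f x = \int[Pa]_x f x.
Proof. by apply: eq_measure_integral => A mA _; exact: a_iid.2. Qed.

Lemma Pa_integrable : Pa.-integrable setT (EFin \o (idfun : R -> R)).
Proof.
apply: (@le_integrable _ _ _ Pa setT measurableT _ (fun x : R => (1 + x ^+ 2)%R%:E)) => //.
  by apply/measurable_EFinP; exact: measurable_id.
  move=> x _ /=; rewrite lee_fin (@ger0_norm _ (1 + x ^+ 2)%R) ?addr_ge0 ?sqr_ge0//.
  by case: (lerP 0 x) => h; rewrite ?(ger0_norm h) ?(ltr0_norm h); nra.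
under eq_fun do rewrite EFinD; apply: integrableD => //.
exact: (finite_measure_integrable_cst Pa 1 measurableT).
Qed.

Lemma integrable_jump k : P.-integrable setT (EFin \o a k).
Proof.
apply/integrableP; split; first exact/measurable_EFinP.
have /integrableP[_] := Pa_integrable.
rewrite -(law_jump k) ge0_integral_distribution//.
by apply: measurableT_comp => //; apply/measurable_EFinP; exact: measurable_id.
Qed.

Lemma integral_jump2 k : P.-integrable setT (fun w => (a k w * a k w)%:E) /\
  \int[P]_w (a k w * a k w)%:E = sigma2%:E.
Proof.
have E : \int[P]_w (a k w * a k w)%:E = sigma2%:E.
  rewrite /sigma2 fineK; last exact: integrable_fin_num.
  rewrite -(law_jump k) ge0_integral_distribution//.
    by case/integrableP : Pa_sq.
  by move=> x; rewrite lee_fin sqr_ge0.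
split => //; apply/integrableP; split.
  by apply/measurable_EFinP; exact: measurable_funM.
under eq_integral do rewrite gee0_abs ?lee_fin -?expr2 ?sqr_ge0// expr2.
by rewrite E ltry.
Qed.

Lemma indep_jump k l (A B : set R) : k != l -> measurable A -> measurable B ->
  P (a k @^-1` A `&` a l @^-1` B) = P (a k @^-1` A) * P (a l @^-1` B).
Proof.
move=> kl mA mB.
have := a_iid.1 [:: k; l] (fun i => if i == k then A else B).
rewrite /= inE kl andbT => /(_ isT) h.
have {}h := h (fun i => ltac:(by case: ifP)).
rewrite !big_cons big_nil mule1 eqxx eq_sym (negbTE kl) in h.
rewrite -h; congr (P _); apply/seteqP; split => w /=.
  by move=> [hA hB] i /=; rewrite !inE => /orP[] /eqP ->; rewrite ?eqxx// eq_sym (negbTE kl).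
move=> hh; split.
  by have := hh k; rewrite /= eqxx; apply; rewrite !inE eqxx.
by have := hh l; rewrite /= eq_sym (negbTE kl); apply; rewrite !inE eqxx orbT.
Qed.

Lemma integral_jumps k l : P.-integrable setT (fun w => (a k w * a l w)%:E) /\
  \int[P]_w (a k w * a l w)%:E = if k == l then sigma2%:E else 0.
Proof.
case: eqVneq => [->|kl]; first exact: integral_jump2.
have [iM ->] := integral_mul_indep (fun A B => @indep_jump k l A B kl)
  (integrable_jump k) (integrable_jump l).
split => //.
have -> : \int[P]_w (a k w)%:E = 0; last by rewrite mul0e.
rewrite -Pa_mean -(law_jump k) integral_distribution//; exact: integrable_jump.
Qed.

(** Takes the place of conditioning on the jump times: [a k * a l] is measurable for the heights and
    [h] for the times, so the expectation factors. *)
Lemma integral_jumps_tau k l (h : T -> R) :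
  measurable_fun setT (h : tauT -> R) -> P.-integrable setT (EFin \o h) ->
  P.-integrable setT (fun w => (a k w * a l w * h w)%:E) /\
  \int[P]_w (a k w * a l w * h w)%:E =
  (if k == l then sigma2%:E else 0) * \int[P]_w (h w)%:E.
Proof.
move=> mh ih; have [iM EM] := integral_jumps k l.
have mh' : measurable_fun setT h by apply/measurable_EFinP; case/integrableP: ih.
have mM : measurable_fun setT (fun w => a k w * a l w)%R by exact: measurable_funM.
have := @integral_mul_indep _ _ _ P (mfun_Sub (mem_set mM)) (mfun_Sub (mem_set mh')) _ iM ih.
rewrite -EM; apply => A B mA mB; apply: a_tau.
- have : measurable_fun setT ((fun w => a k w * a l w)%R
     : sigma_family_type (fun k => a k : T -> R) -> R).
    by apply: measurable_funM; exact: measurable_sigma_family.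
  by move=> /(_ measurableT A mA); rewrite setTI.
- by have := mh measurableT B mB; rewrite setTI.
Qed.

End jumps.

(** * Upper bound *)

Section resid_kernel_facts.
Context {R : realType}.
Implicit Types x y : R.

Lemma resid_kernelC J x y : resid_kernel J x y = resid_kernel J y x.
Proof.
rewrite /resid_kernel maxC; congr (_ - _); apply: eq_bigr => n _; exact: mulrC.
Qed.

(** The kernel is positive semidefinite; testing it on the two points with coefficients 1 and 1,
    then 1 and -1, bounds twice its absolute value by the sum of the diagonal values. This makes the
    off-diagonal weights integrable. *)
Lemma resid_kernel_norm_le1 J x y : 0 <= x <= 1 -> 0 <= y <= 1 -> `|resid_kernel J x y| <= 1.
Proof.
move=> x01 y01.
have H c : 0 <= resid_kernel J x x + 2 * c * resid_kernel J x y + c ^+ 2 * resid_kernel J y y.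
  have u01 : in01 [:: (1, x); (c, y)] by rewrite /= x01 y01.
  have := bessel u01 (iota_uniq 0 (2 ^ J - 0)); rewrite -subr_ge0 step_form_resid_kernel.
  by rewrite !big_cons !big_nil /= (resid_kernelC J y x) => h; apply: le_trans h _;
    rewrite le_eqVlt; apply/orP; left; apply/eqP; ring.
have h1 := H 1; have h2 := H (-1).
have D : 1 <= (2 ^+ J : R) by rewrite exprn_ege1// ler1n.
have D1 : (2 ^+ J : R)^-1 <= 1 by rewrite invf_le1// (lt_le_trans ltr01).
have g1 := le_trans (resid_kernel_le J x01) D1; have g2 := le_trans (resid_kernel_le J y01) D1.
rewrite sqrrN !expr1n in h2; rewrite expr1n in h1.
by rewrite ler_norml; apply/andP; split; lra.
Qed.

Lemma measurable_haar_tail n : measurable_fun setT (haar_tail n : R -> R).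
Proof.
rewrite /haar_tail /step_form; under eq_fun do rewrite big_seq1.
apply: measurable_sum => q /=; apply: measurable_funM; first exact: measurable_cst.
by apply: measurable_funB; [exact: measurable_cst|exact: measurable_maxr].
Qed.

Lemma measurable_resid_kernel d (T : measurableType d) J (f g : T -> R) :
  measurable_fun setT f -> measurable_fun setT g ->
  measurable_fun setT (fun w => resid_kernel J (f w) (g w)).
Proof.
move=> mf mg; rewrite /resid_kernel; apply: measurable_funB.
  by apply: measurable_funB; [exact: measurable_cst|exact: measurable_maxr].
apply: measurable_sum => n; apply: measurable_funM.
- exact: (measurableT_comp (measurable_haar_tail n) mf).
- exact: (measurableT_comp (measurable_haar_tail n) mg).
Qed.

End resid_kernel_facts.

Lemma poisson_prob1 (R : realType) (r : R) n : 0 < r ->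
  poisson_prob r 0 [set n] = (poisson_pmf r n)%:E.
Proof. by move=> r0; rewrite /poisson_prob r0 esum_set1// lee_fin poisson_pmf_ge0. Qed.

Section fset_enum.
(* Only [fset0] is enumerated more than once. *)
Definition fset_enum (i : nat) : {fset nat} := odflt fset0 (pickle_inv i).

Lemma fset_enumK S : fset_enum (choice.pickle S) = S.
Proof. by rewrite /fset_enum pickleK_inv. Qed.

Lemma fset_enum_inj i : fset_enum i != fset0 -> i = choice.pickle (fset_enum i).
Proof.
rewrite /fset_enum; have := pickle_invK (T := {fset nat}) i.
by case: pickle_inv => //= S -> //.
Qed.
End fset_enum.

Section upper.
Context (R : realType) (Pa : probability R R) d (T : measurableType d)
  (P : probability T R) (tau a : nat -> {RV P >-> R}) (lambda : R) (s : R -> T -> R).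
Hypothesis lambda_gt0 : 0 < lambda.
Hypothesis tau_poisson : poisson_point_process lambda tau.
Hypothesis a_iid : iid_with_law Pa a.
Hypothesis a_tau : independent_families P (fun k => a k : T -> R) (fun k => tau k : T -> R).
Hypothesis Pa_mean : (\int[Pa]_x x%:E = 0)%E.
Hypothesis Pa_sq : Pa.-integrable setT (fun x => (x ^+ 2)%:E).
Hypothesis sE : forall t w, 0 <= t <= 1 ->
  s t w = \sum_(k \in [set k | 0 < tau k w <= t]) a k w.

Let sigma2 : R := fine (\int[Pa]_x (x ^+ 2)%:E).
Local Notation tauT := (sigma_family_type (fun k => tau k : T -> R)).
Local Notation unit_itv := (`]0, 1]%classic : set R).
Local Notation K w := [set k | unit_itv (tau k w)].
Local Notation err M w := (sq_L2_norm01 (fun x => s x w - greedy_approx M (s ^~ w) x)).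

Definition path_seq (S : seq nat) w : seq (R * R) := [seq (a k w, tau k w) | k <- S].

Lemma path_seq_in01 (S : {fset nat}) w : K w = [set` S] -> in01 (path_seq S w).
Proof.
move=> KS; apply/allP => p /mapP[k kS ->] /=.
have : K w k by rewrite KS.
by rewrite /= in_itv/= => /andP[/ltW -> ->].
Qed.

Lemma path_stepE (S : {fset nat}) w t : K w = [set` S] -> 0 <= t <= 1 ->
  s t w = step (path_seq S w) t.
Proof.
move=> KS t01; rewrite sE// /step big_map.
have -> (F : nat -> R) : \sum_(k <- S) F k = \sum_(k \in K w) F k.
  by rewrite KS; apply: fsbig_seq; exact: fset_uniq.
rewrite (eq_fsbigr (fun k => a k w * heaviside (tau k w) t)); last first.
  by move=> k; rewrite inE /= /heaviside => /andP[_ ->]; rewrite mulr1.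
case/andP: t01 => t0 t1.
apply: fsbig_widen => k /=; first by move=> /andP[h1 h2]; rewrite in_itv/= h1 (le_trans h2).
rewrite in_itv/= => -[/andP[h1 h2]] h; rewrite /heaviside; case: leP => h3;
  last by rewrite mulr0.
by exfalso; apply: h; rewrite h1.
Qed.

Lemma measurable_K_eq (S : set nat) : measurable ([set w | K w = S] : set tauT).
Proof. by apply: measurable_occupied => // k; exact: measurable_sigma_family. Qed.

Lemma sub_tauT (A : set T) : measurable (A : set tauT) -> measurable A.
Proof. by apply: sigma_family_sub => k. Qed.

(** Bounds the error when exactly the indices in [S] have their points in ]0, 1], and is 0
    otherwise. The indicator is grouped with the kernel so that each term is a product of two
    heights and a bounded functional of the times. *)
Definition cell_err (S : seq nat) J w : R :=
  \sum_(k <- S) \sum_(l <- S) a k w * a l w *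
    (resid_kernel J (tau k w) (tau l w) * \1_[set w | K w = [set` S]] w).

Lemma err_le_cell_err (S : {fset nat}) M w : (0 < M)%N -> K w = [set` S] ->
  (err M w <= (cell_err S ((M - 1) %/ #|` S|) w)%:E)%E.
Proof.
move=> M0 KS.
(* For [S] empty, division by 0 gives J = 0 and the inequality reads 1 <= M. *)
have h : (1 + size (path_seq S w) * ((M - 1) %/ #|` S|) <= M)%N.
  by rewrite size_map mulnC add1n -[ltnRHS](subnK M0) addn1 ltnS leq_trunc_div.
have := greedy_err_le_resid_kernel (path_seq_in01 KS) (fun t => path_stepE (t:=t) KS) h.
move=> /le_trans; apply; rewrite lee_fin le_eqVlt; apply/orP; left; apply/eqP.
rewrite big_map; apply: eq_bigr => k _; rewrite big_map; apply: eq_bigr => l _ /=.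
by rewrite indicE mem_set//= mulr1.
Qed.

Lemma sq_L2_norm01_ge0 (f : R -> R) : (0 <= sq_L2_norm01 f)%E.
Proof. by apply: integral_ge0 => x _; rewrite lee_fin sqr_ge0. Qed.

(** The individual cross terms have no sign; on the event, the sum dominates a squared norm. *)
Lemma cell_err_ge0 (S : {fset nat}) M w : (0 < M)%N ->
  0 <= cell_err S ((M - 1) %/ #|` S|) w.
Proof.
move=> M0; have [KS|KS] := pselect (K w = [set` S]).
  by rewrite -lee_fin; apply: le_trans (err_le_cell_err M0 KS); exact: sq_L2_norm01_ge0.
rewrite /cell_err big1// => k _; rewrite big1// => l _.
by rewrite indicE memNset// !mulr0.
Qed.

Lemma cell_weight_bound (S : {fset nat}) J k l w : k \in S -> l \in S ->
  `|resid_kernel J (tau k w) (tau l w) * \1_[set w | K w = [set` S]] w| <= 1.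
Proof.
move=> kS lS; rewrite indicE; case: (boolP (w \in _)); last by rewrite mulr0 normr0.
rewrite inE /= => KS; rewrite mulr1.
have B i : i \in S -> 0 <= tau i w <= 1.
  move=> iS; have : K w i by rewrite KS.
  by rewrite /= in_itv/= => /andP[/ltW -> ->].
by rewrite resid_kernel_norm_le1 ?B.
Qed.

Lemma measurable_cell_weight (S : {fset nat}) J k l :
  measurable_fun setT ((fun w => resid_kernel J (tau k w) (tau l w) *
    \1_[set w | K w = [set` S]] w) : tauT -> R).
Proof.
apply: measurable_funM; first by apply: measurable_resid_kernel; exact: measurable_sigma_family.
by apply: measurable_indic; exact: measurable_K_eq.
Qed.

Lemma integrable_cell_weight (S : {fset nat}) J k l : k \in S -> l \in S ->
  P.-integrable setT (EFin \o (fun w => resid_kernel J (tau k w) (tau l w) *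
    \1_[set w | K w = [set` S]] w)).
Proof.
move=> kS lS; apply: measurable_bounded_integrable => //.
- exact: (le_lt_trans (probability_le1 P measurableT) (ltry _)).
- apply: measurable_funM; first exact: measurable_resid_kernel.
  by apply: measurable_indic; apply: sub_tauT; exact: measurable_K_eq.
- exists 1; split => // r r1 w _; apply: le_trans (ltW r1).
  exact: cell_weight_bound.
Qed.

Lemma sigma2_ge0 : 0 <= sigma2.
Proof. by apply: fine_ge0; apply: integral_ge0 => x _; rewrite lee_fin sqr_ge0. Qed.

Lemma integral_cell_err_le (S : {fset nat}) J :
  (\int[P]_w (cell_err S J w)%:E <=
   (sigma2 * #|` S|%:R * (2 ^+ J)^-1)%:E * P [set w | K w = [set` S]])%E.
Proof.
pose h k l w := resid_kernel J (tau k w) (tau l w) * \1_[set w | K w = [set` S]] w.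
have H k l : k \in S -> l \in S -> _ := fun kS lS => integral_jumps_tau a_iid a_tau
  Pa_mean Pa_sq k l (@measurable_cell_weight S J k l) (integrable_cell_weight J kS lS).
have mE : measurable [set w | K w = [set` S]] by apply: sub_tauT; exact: measurable_K_eq.
have E : (\int[P]_w (cell_err S J w)%:E =
    \sum_(k <- S) \sum_(l <- S) (if k == l then sigma2%:E else 0) * \int[P]_w (h k l w)%:E)%E.
  (* The membership guard makes the summand integrable for all indices, not only those in [S], as
     the exchange of sum and integral requires. *)
  transitivity (\int[P]_w \sum_(k <- S) \sum_(l <- S)
      (if (k \in S) && (l \in S) then (a k w * a l w * h k l w)%:E else 0))%E.
    apply: eq_integral => w _; rewrite /cell_err -sumEFin big_seq [RHS]big_seq.
    apply: eq_bigr => k kS; rewrite -sumEFin big_seq [RHS]big_seq.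
    by apply: eq_bigr => l lS; rewrite kS lS.
  have I k l : P.-integrable setT
      (fun w => if (k \in S) && (l \in S) then (a k w * a l w * h k l w)%:E else 0%E).
    by case: (boolP ((k \in S) && (l \in S))) => [/andP[kS lS]|_];
      [exact: (H k l kS lS).1|exact: integrable0].
  rewrite integral_sum//; last by move=> k; apply: integrable_sum.
  rewrite big_seq [RHS]big_seq; apply: eq_bigr => k kS.
  rewrite integral_sum// big_seq [RHS]big_seq; apply: eq_bigr => l lS.
  by rewrite kS lS/=; exact: (H k l kS lS).2.
rewrite E.
have Hkk k : k \in S -> (\int[P]_w (h k k w)%:E <= ((2 ^+ J)^-1)%:E * P [set w | K w =
  [set` S]])%E.
  move=> kS.
  have iE := integrable_indic P mE.
  rewrite -[X in P X]setIT -integral_indic// -integralZl//.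
  apply: le_integral => //; [exact: integrable_cell_weight|exact: integrableZl|].
  move=> w _; rewrite /h indicE -EFinM lee_fin.
  case: (boolP (w \in _)) => [|_]; last by rewrite !mulr0.
  rewrite inE /= => KS; rewrite !mulr1 resid_kernel_le//.
  have : K w k by rewrite KS.
  by rewrite /= in_itv/= => /andP[/ltW -> ->].
apply: (@le_trans _ _ (\sum_(k <- S) sigma2%:E * (((2 ^+ J)^-1)%:E * P [set w | K w =
  [set` S]]))%E).
  rewrite big_seq [leRHS]big_seq; apply: lee_sum => k kS.
  rewrite (bigD1_seq k)//= eqxx big1 ?adde0; last first.
    by move=> l lk; rewrite eq_sym (negbTE lk) mul0e.
  by apply: lee_wpmul2l; [rewrite lee_fin sigma2_ge0|exact: Hkk].
have fP := fin_num_measure P _ mE; rewrite -(fineK fP) -!EFinM sumEFin.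
rewrite big_const_seq count_predT iter_addr_0 lee_fin -mulr_natl.
by rewrite le_eqVlt; apply/orP; left; apply/eqP; ring.
Qed.

End upper.

Lemma nneseries_single (R : realType) (f : nat -> \bar R) n :
  (0 <= f n)%E -> (forall i, i != n -> f i = 0)%E -> (\sum_(i <oo) f i = f n)%E.
Proof.
move=> fn f0; rewrite (@nneseriesD1 _ _ n)//=.
  by rewrite eseries0 ?adde0// => i _ /=; exact: f0.
by move=> k _; case: (eqVneq k n) => [->//|/f0 ->].
Qed.

Lemma nneseries_ge_term (R : realType) (f : nat -> \bar R) n :
  (forall i, 0 <= f i)%E -> (f n <= \sum_(i <oo) f i)%E.
Proof.
move=> f0; rewrite (@nneseriesD1 _ _ n)//= leeDl//.
by apply: nneseries_ge0 => i _ _; exact: f0.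
Qed.

(** * The law of the number of jumps *)

Section poisson_counts.
Context (R : realType) d (T : measurableType d) (P : probability T R)
  (tau : nat -> {RV P >-> R}) (lambda : R).
Hypothesis lambda_gt0 : 0 < lambda.
Hypothesis tau_poisson : poisson_point_process lambda tau.
Local Notation tauF := (fun k => tau k : T -> R).
Local Notation unit_itv := (`]0, 1]%classic : set R).

Lemma measurable_tau k : measurable_fun setT (tau k). Proof. by []. Qed.

Lemma prob_count n : P [set w | point_count tauF unit_itv w = n%:R%:E] =
  (poisson_pmf lambda n)%:E.
Proof.
have mu1 : lebesgue_measure unit_itv = 1%E.
  by rewrite lebesgue_measure_itv /= lte_fin ltr01 oppr0 adde0.
by rewrite (poisson_point_count tau_poisson)// ?mu1 ?ltry//= mulr1 poisson_prob1.
Qed.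

Lemma pmf_sum1 : (\sum_(n <oo) (poisson_pmf lambda n)%:E = 1)%E.
Proof.
transitivity (poisson_prob lambda 0 setT); last exact: probability_setT.
rewrite /poisson_prob lambda_gt0 nneseries_esumT// => n.
by rewrite lee_fin poisson_pmf_ge0.
Qed.

(** The finite counts already exhaust the mass, as the Poisson weights sum to 1. *)
Lemma prob_count_infinite : P [set w | point_count tauF unit_itv w = +oo%E] = 0%E.
Proof.
pose F n := [set w | point_count tauF unit_itv w = n%:R%:E].
have mF n : measurable (F n) by exact: measurable_point_count_eq.
have tF : trivIset setT F.
  apply/trivIsetP => i j _ _ ij; rewrite -subset0 => w /= [h1 h2].
  have /= [/eqP] := etrans (esym h1) h2.
  by rewrite eqr_nat (negbTE ij).
have E : [set w | point_count tauF unit_itv w = +oo%E] = ~` \bigcup_n F n.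
  apply/seteqP; split => w /=.
    by move=> h [n _]; rewrite /F /= h.
  move=> h; rewrite /point_count /counting; case: ifPn => // /asboolP fin.
  exfalso; apply: h; exists #|` fset_set [set k | unit_itv (tau k w)]| => //.
  by rewrite /F /= /point_count /counting asboolT.
rewrite E probability_setC; last exact: bigcupT_measurable.
rewrite measure_bigcup//= -[X in (X - _)%E]pmf_sum1.
rewrite (_ : \big[_/_]_(0 <= i <oo | i \in setT) _ =
  \sum_(n <oo) (poisson_pmf lambda n)%:E)%E; first by rewrite pmf_sum1 subee.
rewrite (eq_eseriesl (Q := xpredT)); last by move=> n; rewrite in_setT.
by apply: eq_eseriesr => n _; exact: prob_count.
Qed.

Lemma integral_count (phi : nat -> R) : (forall n, 0 <= phi n) ->
  (\int[P]_w (\sum_(n <oo) (phi n * \1_[set w | point_count tauF unit_itv w = n%:R%:E] w)%:E) =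
   \sum_(n <oo) (phi n * poisson_pmf lambda n)%:E)%E.
Proof.
move=> phi0; rewrite integral_nneseries//; last 2 first.
- move=> n; apply/measurable_EFinP; apply: measurable_funM => //.
  by apply: measurable_indic; exact: measurable_point_count_eq.
- by move=> n w _; rewrite lee_fin mulr_ge0.
apply: eq_eseriesr => n _; under eq_integral do rewrite EFinM.
have mF : measurable [set w | point_count tauF unit_itv w = n%:R%:E].
  exact: measurable_point_count_eq.
rewrite ge0_integralZl_EFin//; last exact/measurable_EFinP/measurable_indic.
by rewrite integral_indic// setIT EFinM; congr (_ * _)%E; exact: prob_count.
Qed.

End poisson_counts.

Section upper.
Context (R : realType) (Pa : probability R R) d (T : measurableType d)
  (P : probability T R) (tau a : nat -> {RV P >-> R}) (lambda : R) (s : R -> T -> R).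
Hypothesis lambda_gt0 : 0 < lambda.
Hypothesis tau_poisson : poisson_point_process lambda tau.
Hypothesis a_iid : iid_with_law Pa a.
Hypothesis a_tau : independent_families P (fun k => a k : T -> R) (fun k => tau k : T -> R).
Hypothesis Pa_mean : (\int[Pa]_x x%:E = 0)%E.
Hypothesis Pa_sq : Pa.-integrable setT (fun x => (x ^+ 2)%:E).
Hypothesis sE : forall t w, 0 <= t <= 1 ->
  s t w = \sum_(k \in [set k | 0 < tau k w <= t]) a k w.
Local Notation tauF := (fun k => tau k : T -> R).
Local Notation unit_itv := (`]0, 1]%classic : set R).
Local Notation K w := [set k | unit_itv (tau k w)].

Let sigma2 : R := fine (\int[Pa]_x (x ^+ 2)%:E).

Definition upper_weight M n : R := sigma2 * n%:R * (2 ^+ ((M - 1) %/ n))^-1.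

Lemma upper_weight_ge0 M n : 0 <= upper_weight M n.
Proof. by rewrite !mulr_ge0 ?invr_ge0 ?exprn_ge0//; exact: sigma2_ge0. Qed.

Lemma point_count_fset (S : {fset nat}) w : K w = [set` S] ->
  point_count tauF unit_itv w = #|` S|%:R%:E.
Proof.
by move=> KS; rewrite /point_count /counting KS asboolT// set_fsetK.
Qed.

Lemma finite_K w : point_count tauF unit_itv w != +oo%E ->
  exists S : {fset nat}, K w = [set` S].
Proof.
rewrite /point_count /counting; case: ifPn => // /asboolP fin _.
by exists (fset_set (K w)); rewrite fset_setK.
Qed.

Lemma mse_greedy_le M : (0 < M)%N ->
  (mse_greedy P s M <= \sum_(n <oo) (upper_weight M n * poisson_pmf lambda n)%:E)%E.
Proof.
move=> M0; pose J (S : {fset nat}) := ((M - 1) %/ #|` S|)%N.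
pose V i w := (cell_err tau a (fset_enum i) (J (fset_enum i)) w)%:E.
have V0 i w : (0 <= V i w)%E by rewrite lee_fin (cell_err_ge0 sE).
have mV i : measurable_fun setT (V i).
  apply/measurable_EFinP; apply: measurable_sum => k; apply: measurable_sum => l.
  apply: measurable_funM; first exact: measurable_funM.
  apply: measurable_funM; first exact: measurable_resid_kernel.
  by apply: measurable_indic; exact: measurable_occupied.
(* Almost surely the occupied index set is finite, hence is some [fset_enum i], and that single term
   already dominates the error. The sum is measurable although the error is not known to be. *)
apply: (@le_trans _ _ (\int[P]_w \sum_(i <oo) V i w)%E).
  apply: (@le_integral_measurable_r _ _ _ P
    [set w | point_count tauF unit_itv w = +oo%E]) => //.
  - have := measurable_point_count (@measurable_tau _ _ _ P tau)
      (measurable_itv `]0, 1] : measurable unit_itv) measurableT (emeasurable_set1 +oo%E).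
    by rewrite setTI.
  - exact: prob_count_infinite tau_poisson.
  - by move=> w; exact: sq_L2_norm01_ge0.
  - by move=> w; apply: nneseries_ge0 => i _ _; exact: V0.
  - by apply: ge0_emeasurable_sum => i *; [exact: V0|exact: mV].
  move=> w /eqP /finite_K[S KS].
  apply: le_trans (nneseries_ge_term (choice.pickle S) _); last by move=> i; exact: V0.
  by rewrite /V fset_enumK; exact: (err_le_cell_err sE M0 KS).
rewrite integral_nneseries//.
pose E i := [set w | K w = [set` fset_enum i]].
have mE i : measurable (E i) by exact: measurable_occupied.
apply: (@le_trans _ _ (\sum_(i <oo) \int[P]_w (upper_weight M #|` fset_enum i| * \1_(E i)
  w)%:E)%E).
  apply: lee_nneseries => [i _ _|i _]; first by apply: integral_ge0 => w _; exact: V0.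
  apply: le_trans (integral_cell_err_le a_iid a_tau Pa_mean Pa_sq _ _) _.
  rewrite [leRHS](_ : _ =
      \int[P]_w ((upper_weight M #|` fset_enum i|)%:E * (\1_(E i) w)%:E))%E; last first.
    by apply: eq_integral => w _; rewrite EFinM.
  rewrite ge0_integralZl_EFin//;
    [|exact/measurable_EFinP/measurable_indic|exact: upper_weight_ge0].
  by rewrite integral_indic// setIT.
rewrite -integral_nneseries//; last 2 first.
- move=> i; apply/measurable_EFinP.
  by apply: measurable_funM; [exact: measurable_cst|exact: measurable_indic].
- by move=> i w _; rewrite lee_fin mulr_ge0// upper_weight_ge0.
rewrite -(integral_count lambda_gt0 tau_poisson); last by move=> n; exact: upper_weight_ge0.
(* Regroups the sets [S] by cardinality: on a path only the term of the occupied set can be nonzero,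
   and it is the term of its cardinality on the right. *)
apply: le_integral_pointwise => w.
  by apply: nneseries_ge0 => i _ _; rewrite lee_fin mulr_ge0// upper_weight_ge0.
have R0 n : (0 <= (upper_weight M n *
    \1_[set w | point_count tauF unit_itv w = n%:R%:E] w)%:E)%E.
  by rewrite lee_fin mulr_ge0// upper_weight_ge0.
(* The weight of the empty set is 0, so its repeated enumeration does no harm. *)
have L0 i : ~ E i w \/ fset_enum i = fset0 ->
    (upper_weight M #|` fset_enum i| * \1_(E i) w)%:E = 0%E.
  move=> [nE|->]; first by rewrite indicE memNset// mulr0.
  by rewrite cardfs0 /upper_weight mulr0 !mul0r.
have [[i [Ei i0]]|h] := pselect (exists i, E i w /\ fset_enum i != fset0); last first.
  rewrite eseries0; last first.
    move=> i _ _; apply: L0; apply: contrapT => /not_orP[/contrapT Ei /eqP i0].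
    by apply: h; exists i.
  by apply: nneseries_ge0.
rewrite (@nneseries_single _ _ i); last first.
- move=> j ji; apply: L0; apply: contrapT => /not_orP[/contrapT Ej /eqP j0].
  move: ji; rewrite (fset_enum_inj i0) (fset_enum_inj j0) => /eqP; apply.
  congr choice.pickle; apply/fsetP => k; apply/idP/idP => kk.
    have : K w k by rewrite Ej.
    by rewrite Ei.
  have : K w k by rewrite Ei.
  by rewrite Ej.
- by rewrite lee_fin mulr_ge0// upper_weight_ge0.
apply: le_trans (nneseries_ge_term #|` fset_enum i| R0).
rewrite lee_fin ler_wpM2l ?upper_weight_ge0// !indicE !mem_set//=.
exact: point_count_fset.
Qed.

End upper.

(** * Lower bound *)

Section point_counts.
Context d (T : measurableType d) (R : realType) (X : nat -> T -> R).
Implicit Types A B : set R.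

Lemma point_countU A B w : A `&` B = set0 ->
  point_count X (A `|` B) w = (point_count X A w + point_count X B w)%E.
Proof.
move=> AB; rewrite !point_countE -nneseriesD//; apply: eq_eseriesr => k _.
rewrite -EFinD; congr EFin; rewrite !indicE in_setU.
case: (boolP (_ \in A)) => hA; case: (boolP (_ \in B)) => hB /=; rewrite ?addr0 ?add0r//.
have : (A `&` B) (X k w) by split; exact: set_mem.
by rewrite AB.
Qed.

Lemma point_count_bigU (B : nat -> set R) m w : trivIset setT B ->
  point_count X (\big[setU/set0]_(i < m) B i) w = (\sum_(i < m) point_count X (B i) w)%E.
Proof.
move=> tB; elim: m => [|m IH].
  by rewrite !big_ord0 point_countE eseries0// => k _ _; rewrite indic0.
rewrite !big_ord_recr/= point_countU ?IH//.
rewrite big_distrl/= big1// => i _.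
by move/trivIsetP : tB; apply => //; rewrite neq_ltn ltn_ord.
Qed.

Lemma point_count0P A w : point_count X A w = 0%E -> forall k, ~ A (X k w).
Proof.
move=> h k Ak; have : ((\1_A (X k w))%:E <= point_count X A w)%E.
  by rewrite point_countE; exact: (@nneseries_ge_term _ (fun k => (\1_A (X k w))%:E) k).
by rewrite h indicE mem_set//= lee_fin ler10.
Qed.

End point_counts.

Section cells.
Context {R : realType}.
Implicit Types x : R.

(** Half-open, so that the cells partition ]0, 1]; they differ from the open [incell] at dyadic
    points only. *)
Definition cell j i : set R := `]dyad j i, dyad j i.+1].

(** The middle half of [cell J k], between its first and third quarter points. *)
Definition mid_cell J k : set R := `]dyad J.+2 (4 * k + 1), dyad J.+2 (4 * k + 3)].

Lemma measurable_cell j i : measurable (cell j i).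
Proof. exact: measurable_itv. Qed.

Lemma measurable_mid_cell J k : measurable (mid_cell J k).
Proof. exact: measurable_itv. Qed.

Lemma trivIset_cell j : trivIset setT (cell j).
Proof.
apply/trivIsetP => i i' _ _; wlog ii' : i i' / (i < i')%N.
  move=> H; case: (ltngtP i i') => [h _|h _|->] //.
    by apply: H => //; rewrite neq_ltn h.
  by rewrite setIC; apply: H => //; rewrite neq_ltn h.
move=> _; rewrite -subset0 => x []; rewrite /cell /= !in_itv /= => /andP[_ h1] /andP[h2 _].
by have := lt_le_trans h2 (le_trans h1 (dyad_le j ii')); rewrite ltxx.
Qed.

Lemma cell_inj j i i' x : cell j i x -> cell j i' x -> i = i'.
Proof.
move=> h1 h2; apply/eqP; apply: contrapT => /negP ii'.
have /trivIsetP/(_ i i' I I ii') := @trivIset_cell j.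
by rewrite -subset0 => /(_ x); apply.
Qed.

Lemma bigU_cell j m : \big[setU/set0]_(i < m) cell j i = `]0, dyad j m]%classic.
Proof.
elim: m => [|m IH].
  rewrite big_ord0; apply/esym; rewrite -subset0 => x /=; rewrite in_itv /= /dyad mul0r.
  by move=> /andP[h1 h2]; have := lt_le_trans h1 h2; rewrite ltxx.
have dm := dyad_lt (R := R) j (ltnSn m); have d0 := dyad_ge0 (R := R) j m.
rewrite big_ord_recr/= IH; apply/seteqP; split => x; rewrite /cell /= !in_itv/=.
  by move=> [/andP[h1 h2]|/andP[h1 h2]]; apply/andP; split; lra.
move=> /andP[h1 h2]; case: (leP x (dyad j m)) => h; [left|right].
  by rewrite h1.
by [].
Qed.

Lemma cells_unit j : \big[setU/set0]_(i < 2 ^ j) cell j i = `]0, 1]%classic.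
Proof. by rewrite bigU_cell dyad1. Qed.

Lemma measure_cell j i : lebesgue_measure (cell j i) = (2 ^+ j : R)^-1%:E.
Proof.
rewrite lebesgue_measure_itv /= lte_fin dyad_lt// -EFinD dyadS; congr EFin; ring.
Qed.

Lemma measure_mid_cell J k : lebesgue_measure (mid_cell J k) = ((2 ^+ J)^-1 / 2 : R)%:E.
Proof.
rewrite lebesgue_measure_itv /= lte_fin dyad_lt ?ltn_add2l// -EFinD; congr EFin.
by rewrite /dyad (natrD _ _ 3) (natrD _ _ 1) natrM 2!exprS; field; rewrite expf_neq0.
Qed.

Lemma mid_cell_sub j q i r : (r < 2 ^ q)%N ->
  mid_cell (j + q) (i * 2 ^ q + r) `<=` cell j i.
Proof.
move=> rq x; rewrite /mid_cell /cell /= !in_itv /= => /andP[h1 h2].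
have E k : dyad j k = dyad (j + q).+2 (k * 2 ^ q.+2) :> R.
  by rewrite -!addnS dyad_mulX.
apply/andP; split.
  apply: le_lt_trans h1; rewrite E dyad_le// !expnS; lia.
apply: le_trans h2 _; rewrite E dyad_le// !expnS; nia.
Qed.

End cells.

Section poisson_cells.
Context (R : realType) d (T : measurableType d) (P : probability T R)
  (tau : nat -> {RV P >-> R}) (lambda : R).
Hypothesis lambda_gt0 : 0 < lambda.
Hypothesis tau_poisson : poisson_point_process lambda tau.
Local Notation tauF := (fun k => tau k : T -> R).

(** Both values of the count have factorial 1; r = 0 falls under the Dirac convention of
    [poisson_prob]. *)
Lemma prob_count_bool (B : set R) r (v : bool) : measurable B ->
  lebesgue_measure B = r%:E -> 0 <= r ->
  P [set w | point_count tauF B w = v%:R%:E] =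
  ((lambda * r) ^+ v * expR (- (lambda * r)))%:E.
Proof.
move=> mB Br r0; rewrite (poisson_point_count tau_poisson)// Br ?ltry//=.
have [->|rn0] := eqVneq r 0.
  rewrite mulr0 oppr0 expR0 mulr1 /poisson_prob ltxx /dirac indicE; congr EFin.
  by case: v; rewrite ?expr0 ?expr1; [rewrite memNset|rewrite mem_set].
have lr : 0 < lambda * r by rewrite mulr_gt0// lt_neqAle eq_sym rn0.
rewrite poisson_prob1// /poisson_pmf lr; congr (_ * _)%:E.
by case: v; rewrite /= invr1 mulr1.
Qed.

Definition cell_pattern j (A : {set 'I_(2 ^ j)}) : set T :=
  [set w | forall i : 'I_(2 ^ j), point_count tauF (cell j i) w = (i \in A)%:R%:E].

(** With h = 2^-j, independence gives lambda r0 (lambda h)^(|A| - 1) e^-lambda: requiring the point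
    of cell [i0] to lie in [B0] costs exactly the proportion r0 / h. *)
Lemma prob_cell_pattern_mid j (A : {set 'I_(2 ^ j)}) (i0 : 'I_(2 ^ j))
    (B0 : set R) (r0 : R) : i0 \in A -> measurable B0 -> B0 `<=` cell j i0 ->
  lebesgue_measure B0 = r0%:E ->
  ((r0 * 2 ^+ j * (lambda / 2 ^+ j) ^+ #|A| * expR (- lambda))%:E <=
   P (cell_pattern A `&` [set w | point_count tauF B0 w = 1%E]))%E.
Proof.
move=> i0A mB0 B0sub B0r; set m := (2 ^ j)%N in A i0 i0A B0sub *.
have r00 : 0 <= r0 by rewrite -lee_fin -B0r.
have h0 : 0 < (2 ^+ j : R)^-1 by rewrite invr_gt0 exprn_gt0.
set h := (2 ^+ j : R)^-1 in h0.
(* A partition of ]0, 1] into m + 1 pieces: cell [i0] loses [B0], which becomes piece number [m].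
   The required counts [v] are 0 in what is left of cell [i0] and 1 in [B0]. *)
pose B (i : nat) : set R := if insub i is Some i' then
  (if i' == i0 then cell j i0 `\` B0 else cell j (val (i' : 'I_m))) else
  if i == m then B0 else set0.
pose v (i : nat) : bool := if insub i is Some i' then (i' != i0) && ((i' : 'I_m) \in A)
  else true.
have BI (i : 'I_m) : B i = if i == i0 then cell j i0 `\` B0 else cell j i.
  by rewrite /B valK.
have Bm : B m = B0 by rewrite /B insubN ?ltnn// eqxx.
have vI (i : 'I_m) : v i = (i != i0) && (i \in A) by rewrite /v valK.
have vm : v m = true by rewrite /v insubN ?ltnn.
have mB i : measurable (B i).
  rewrite /B; case: insubP => [i' _ _|_]; case: ifP => // _; last exact: measurable_cell.
  by apply: measurableD => //; exact: measurable_cell.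
have Bsub (i : 'I_m) : B i `<=` cell j i.
  by rewrite BI; case: eqP => [->|_] //; exact: subDsetl.
have tB : trivIset setT B.
  apply/trivIsetP => i i' _ _; wlog ii' : i i' / (i < i')%N.
    move=> H; case: (ltngtP i i') => [lt _|lt _|->] //.
      by apply: H => //; rewrite neq_ltn lt.
    by rewrite setIC; apply: H => //; rewrite neq_ltn lt.
  move=> _; rewrite -subset0 => x [].
  have [i'm|mi'] := ltnP i' m.
    move=> /(Bsub (Ordinal (ltn_trans ii' i'm))) h1 /(Bsub (Ordinal i'm)) h2.
    by have := cell_inj h1 h2 => /= E; move: (ii'); rewrite E ltnn.
  rewrite {2}/B insubN -?leqNgt//; case: eqP => // i'E; rewrite i'E in ii'.
  move=> h1 h2; have := cell_inj (Bsub (Ordinal ii') _ h1) (B0sub _ h2) => /= E.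
  by move: h1; rewrite -[i]/(val (Ordinal ii')) BI -val_eqE /= E eqxx => -[].
have indep := poisson_point_indep tau_poisson mB tB.
have {}indep := indep (iota 0 m.+1) (fun i => [set (v i)%:R%:E]) (iota_uniq _ _)
  (fun i => emeasurable_set1 _).
pose r (i : nat) : R := if insub i is Some i' then
  (if (i' : 'I_m) == i0 then h - r0 else h) else r0.
have mr i : (i <= m)%N -> lebesgue_measure (B i) = (r i)%:E.
  rewrite leq_eqVlt => /orP[/eqP ->|im]; first by rewrite Bm /r insubN ?ltnn.
  rewrite -[i]/(val (Ordinal im)) BI /r valK; case: eqP => _; last exact: measure_cell.
  rewrite measureD//; [|exact: measurable_cell|by rewrite [X in (X < _)%E]measure_cell ltry].
  rewrite (setIidr B0sub); rewrite [X in (X - _)%E]measure_cell.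
  by rewrite [X in (_ - X)%E]B0r EFinB.
have r_ge0 i : (i <= m)%N -> 0 <= r i.
  by move=> im; rewrite -lee_fin -mr.
have PE : (P (\bigcap_(i in [set` iota 0 m.+1]) point_count tauF (B i) @^-1` [set (v
  i)%:R%:E]) =
    (\prod_(i < m.+1) ((lambda * r i) ^+ v i * expR (- (lambda * r i))))%:E)%E.
  rewrite indep -prodEFin -[iota _ _]/(index_iota 0 m.+1) big_mkord; apply: eq_bigr => i _.
  have im : (i <= m)%N by rewrite -ltnS.
  by rewrite -(prob_count_bool (v i) (mB i) (mr i im) (r_ge0 i im)).
have mcount (C : set R) (n : nat) : measurable C ->
    measurable [set w | point_count tauF C w = n%:R%:E].
  by move=> mC; exact: measurable_point_count_eq.
apply: (@le_trans _ _ (P (\bigcap_(i in [set` iota 0 m.+1])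
    point_count tauF (B i) @^-1` [set (v i)%:R%:E]))); last first.
  apply: le_measure; rewrite ?inE.
  - apply: fin_bigcap_measurable => [|i _]; first exact: finite_seq.
    exact: mcount.
  - apply: measurableI; last exact: (mcount _ 1%N).
    rewrite (_ : cell_pattern A = \bigcap_(i in [set: 'I_m])
        [set w | point_count tauF (cell j i) w = (i \in A)%:R%:E]).
      by apply: fin_bigcap_measurable => // i _; apply: mcount; exact: measurable_cell.
    by apply/seteqP; split => w /= h' i; [move=> _|]; exact: h'.
  move=> w H; have H' i : (i <= m)%N -> point_count tauF (B i) w = (v i)%:R%:E.
    move=> im; have := H i; apply.
    by rewrite /mkset mem_iota add0n ltnS.
  have c0 : point_count tauF B0 w = 1%E by rewrite -Bm H'// vm.
  split => // i; have := H' i (ltnW (ltn_ord i)); rewrite BI vI.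
  have [->|ii0]//= := eqVneq i i0; move=> c1.
  rewrite -(setDUK B0sub) point_countU; last by rewrite setDE setIC -setIA setICl setI0.
  by rewrite c0 c1 i0A adde0.
rewrite PE lee_fin big_ord_recr/= vm /r insubN ?ltnn// expr1.
pose F (i : 'I_m) := (lambda * h) ^+ (i \in A) * expR (- (lambda * h)).
have FA : \prod_(i < m) F i = (lambda * h) ^+ #|A| * expR (- lambda).
  rewrite /F big_split /= prodr_const card_ord prodrXr; congr (_ * _).
    by congr (_ ^+ _); rewrite -sum1_card [RHS]big_mkcond; apply: eq_bigr => i _;
      case: (i \in A).
  by rewrite -expRM_natl mulrN; congr (expR (- _));
    rewrite /m natrX mulrCA divff ?mulr1// expf_neq0.
rewrite (bigD1 i0)//= vI valK eqxx /= expr0 mul1r.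
rewrite (eq_bigr F); last first.
  by move=> i ii0; rewrite vI valK (negbTE ii0).
move: FA; rewrite (bigD1 i0)//= {1}/F i0A expr1 => FA.
rewrite le_eqVlt; apply/orP; left; apply/eqP.
rewrite -[lambda / _]/(lambda * h) -[LHS]mulrA -FA -[2 ^+ j]invrK -/h.
move: (\prod_(i < m | i != i0) F i) => rest.
have -> : expR (- (lambda * (h - r0))) = expR (- (lambda * h)) / expR (- (lambda * r0)).
  by rewrite -expRN -expRD; congr expR; ring.
by field; rewrite !gt_eqF// expR_gt0.
Qed.

End poisson_cells.

(** Lets lower bounds supported on disjoint events be added up and still stay below the error. *)
Lemma sum_disjoint_le (R : realType) (I : finType) (Q : pred I) (f : I -> \bar R) (b : \bar R) :
  (0 <= b)%E -> (forall i, Q i -> f i <= b)%E ->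
  (forall i i', Q i -> Q i' -> f i != 0 -> f i' != 0 -> i = i')%E ->
  (\sum_(i | Q i) f i <= b)%E.
Proof.
move=> b0 fb single.
have [/existsP[i /andP[Qi fi]]|] := boolP [exists i, Q i && (f i != 0%E)].
  rewrite (bigD1 i)//= big1 ?adde0 ?fb// => i' /andP[Qi' i'i].
  by apply/eqP; apply: contraNT i'i => fi'; apply/eqP; exact: single.
rewrite negb_exists => /forallP h; rewrite big1// => i Qi.
by have := h i; rewrite Qi /= negbK => /eqP.
Qed.

Lemma measurable_indic_comp d (T : measurableType d) (R : realType) (X : T -> R)
    (A : set R) : measurable_fun setT X -> measurable A ->
  measurable_fun setT (fun w => \1_A (X w) : R).
Proof.
move=> mX mA; have m1 : measurable_fun setT (\1_A : R -> R) by exact: measurable_indic.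
exact: (measurableT_comp m1 mX).
Qed.

Lemma subcell_index_lt j q i r :
  (i < 2 ^ j -> r < 2 ^ q -> i * 2 ^ q + r < 2 ^ (j + q))%N.
Proof. by rewrite expnD; nia. Qed.

Section lower.
Context (R : realType) (Pa : probability R R) d (T : measurableType d)
  (P : probability T R) (tau a : nat -> {RV P >-> R}) (lambda : R) (s : R -> T -> R).
Hypothesis lambda_gt0 : 0 < lambda.
Hypothesis tau_poisson : poisson_point_process lambda tau.
Hypothesis a_iid : iid_with_law Pa a.
Hypothesis a_tau : independent_families P (fun k => a k : T -> R) (fun k => tau k : T -> R).
Hypothesis Pa_mean : (\int[Pa]_x x%:E = 0)%E.
Hypothesis Pa_sq : Pa.-integrable setT (fun x => (x ^+ 2)%:E).
Hypothesis Pa0 : Pa [set 0] = 0%E.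
Hypothesis sE : forall t w, 0 <= t <= 1 ->
  s t w = \sum_(k \in [set k | 0 < tau k w <= t]) a k w.
Local Notation tauF := (fun k => tau k : T -> R).
Local Notation tauT := (sigma_family_type tauF).
Local Notation unit_itv := (`]0, 1]%classic : set R).
Local Notation K w := [set k | unit_itv (tau k w)].
Local Notation err M w := (sq_L2_norm01 (fun x => s x w - greedy_approx M (s ^~ w) x)).

Let sigma2 : R := fine (\int[Pa]_x (x ^+ 2)%:E).

Definition regular w := (forall k, a k w != 0) /\ (forall k j i, tau k w != dyad j i).

(** The heights avoid 0 because [Pa] has no atom there. The times avoid each of the countably many
    dyadic points because the count of a Lebesgue-null set is almost surely 0. *)
Lemma regular_ae : exists N : set T,
  [/\ measurable N, P N = 0%E & forall w, ~ N w -> regular w].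
Proof.
have ma k : measurable (a k @^-1` [set 0]).
  by rewrite -[X in measurable X]setTI; exact: (measurable_funP (a k)).
have mt k x : measurable (tau k @^-1` [set x]).
  by rewrite -[X in measurable X]setTI; exact: (measurable_funP (tau k)).
have Na k : P.-negligible (a k @^-1` [set 0]).
  by apply/negligibleP => //; rewrite -[LHS]/(distribution P (a k) [set 0]) a_iid.2.
have Nt k x : P.-negligible (tau k @^-1` [set x]).
  have m1 : measurable [set w | point_count tauF [set x] w = 0%E].
    by apply: (@measurable_point_count_eq _ _ _ tauF _ _ 0).
  have := poisson_point_count tau_poisson 0 (measurable_set1 x).
  rewrite lebesgue_measure_set1 /= mulr0 /poisson_prob ltxx => /(_ (ltry _)) h.
  exists (~` [set w | point_count tauF [set x] w = 0%E]); split.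
  - exact: measurableC.
  - rewrite probability_setC// [X in (1 - X)%E]h /dirac indicE mem_set//.
    by rewrite subee.
  - by move=> w /= tw h0; exact: (point_count0P h0 tw).
have [N [mN N0 sub]] : P.-negligible (\bigcup_k (a k @^-1` [set 0] `|`
    \bigcup_j \bigcup_i (tau k @^-1` [set dyad j i]))).
  apply: negligible_bigcup => k; apply: negligibleU => //.
  by apply: negligible_bigcup => j; apply: negligible_bigcup => i.
exists N; split => // w Nw; split.
- by move=> k; apply/eqP => ak; apply: Nw; apply: sub; exists k => //; left.
- move=> k j i; apply/eqP => tk; apply: Nw; apply: sub; exists k => //; right.
  by exists j => //; exists i.
Qed.

(** Sums over all indices, not over the random occupied set, so that it is measurable and can be
    integrated term by term. *)
Definition mid_energy J k w : \bar R :=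
  (\sum_(i <oo) (a i w * a i w * \1_(mid_cell J k) (tau i w))%:E)%E.

Lemma mid_energy_ge0 J k w : (0 <= mid_energy J k w)%E.
Proof. by apply: nneseries_ge0 => i _ _; rewrite lee_fin mulr_ge0// -expr2 sqr_ge0. Qed.

Lemma measurable_mid_term J k i :
  measurable_fun setT ((fun w => \1_(mid_cell J k) (tau i w)) : tauT -> R).
Proof.
apply: measurable_indic_comp; last exact: measurable_mid_cell.
exact: (@measurable_sigma_family _ _ _ _ _ tauF i).
Qed.

Lemma measurable_mid_energy J k : measurable_fun setT (mid_energy J k).
Proof.
apply: ge0_emeasurable_sum => i *; first by rewrite lee_fin mulr_ge0// -expr2 sqr_ge0.
apply/measurable_EFinP; apply: measurable_funM; first exact: measurable_funM.
by apply: measurable_indic_comp => //; exact: measurable_mid_cell.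
Qed.

Lemma mid_cell_unit J k : (k < 2 ^ J)%N -> mid_cell J k `<=` unit_itv.
Proof.
move=> kJ x xm.
have : cell J k x.
  have := @mid_cell_sub R J 0 k 0 isT; rewrite !addn0 expn0 muln1; exact.
rewrite -(cells_unit J) => h; rewrite -bigcup_mkord; by exists k.
Qed.

Lemma mid_energyE (S : {fset nat}) J k w : K w = [set` S] -> (k < 2 ^ J)%N ->
  mid_energy J k w = (\sum_(i <- S) a i w * a i w * \1_(mid_cell J k) (tau i w))%:E.
Proof.
move=> KS kJ; rewrite /mid_energy nneseries_esumT; last first.
  by move=> i; rewrite lee_fin mulr_ge0// -expr2 sqr_ge0.
rewrite [LHS](_ : _ = \esum_(i in [set` S]) (a i w * a i w * \1_(mid_cell J k) (tau i w))%:E)%E.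
  rewrite esum_fset//; last by move=> i _; rewrite lee_fin mulr_ge0// -expr2 sqr_ge0.
  by rewrite -sumEFin; apply/esym; apply: fsbig_seq; exact: fset_uniq.
rewrite [RHS]esum_mkcond; apply: eq_esum => i _; case: ifPn => // iS.
rewrite indicE memNset ?mulr0// => /(mid_cell_unit kJ) h.
by move: iS; rewrite -KS => /negP; apply; rewrite inE.
Qed.

Lemma cell_pattern_count j (A : {set 'I_(2 ^ j)}) w : cell_pattern tau A w ->
  point_count tauF unit_itv w = #|A|%:R%:E.
Proof.
move=> Aw; rewrite -(cells_unit j) point_count_bigU; last exact: trivIset_cell.
rewrite (eq_bigr (fun i : 'I_(2 ^ j) => (i \in A)%:R%:E)); last by move=> i _; exact: Aw.
rewrite sumEFin -sum1_card natr_sum; congr EFin; rewrite [RHS]big_mkcond.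
by apply: eq_bigr => i _; case: (i \in A).
Qed.

(** The pattern separates the jumps at level [j], so the budget is spent before level j + q, and the
    error is at least the energy of that level. Of this energy only the jumps in middle halves are
    retained, each with the factor of [tent_mid]. *)
Lemma mid_energy_le_err j q (A : {set 'I_(2 ^ j)}) M w : regular w ->
  cell_pattern tau A w -> (M <= #|A| * q)%N ->
  (((16 * 2 ^+ (j + q))^-1)%:E *
     (\sum_(i in A) \sum_(r < 2 ^ q) mid_energy (j + q) (i * 2 ^ q + r) w) <=
   err M w)%E.
Proof.
move=> [a0 t0] Aw MA.
have cA := cell_pattern_count Aw.
have [S KS] : exists S : {fset nat}, K w = [set` S] by apply: finite_K; rewrite cA.
have SA : #|` S| = #|A|.
  have := point_count_fset KS; rewrite cA => -[/eqP]; rewrite eqr_nat => /eqP <- //.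
have sep k : (k < 2 ^ j)%N -> (ncell j k (path_seq tau a S w) <= 1)%N.
  move=> kj; have := Aw (Ordinal kj); rewrite /point_count /counting /=.
  case: ifPn => // /asboolP fin [/eqP]; rewrite eqr_nat => /eqP c1.
  rewrite /ncell count_map; apply: (@leq_trans (nat_of_bool (Ordinal kj \in A)));
    last exact: leq_b1.
  rewrite -c1 -size_filter; apply: uniq_leq_size; first exact/filter_uniq/fset_uniq.
  move=> i; rewrite mem_filter /= => /andP[/andP[h1 h2] _].
  by rewrite in_fset_set// inE /= /cell /= in_itv/= h1 ltW.
have un p : p \in path_seq tau a S w -> p.1 != 0 /\ forall j k, p.2 != dyad j k.
  by move=> /mapP[i iS ->] /=.
have Mq : (M <= size (path_seq tau a S w) * q)%N by rewrite size_map SA.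
have := @greedy_err_tent_ge _ (s ^~ w) _ (path_seq_in01 a KS)
  (fun t => path_stepE sE (t:=t) KS) M j q Mq sep un.
apply: le_trans.
have kJ (i : 'I_(2 ^ j)) (r : 'I_(2 ^ q)) : (i * 2 ^ q + r < 2 ^ (j + q))%N.
  exact: subcell_index_lt.
under eq_bigr => i _ do under eq_bigr => r _ do rewrite (mid_energyE KS (kJ i r)).
under eq_bigr => i _ do rewrite sumEFin.
rewrite sumEFin -EFinM lee_fin.
pose F k := \sum_(i <- S) (a i w * tent (j + q) k (tau i w)) ^+ 2.
have F0 k : 0 <= F k by apply: sumr_ge0 => i _; exact: sqr_ge0.
rewrite (eq_bigr F); last by move=> k _; rewrite big_map.
(* A cell of level j + q is the [r]-th of the 2^q subcells of a cell [i] of level [j]; those with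
   [i] outside [A] are dropped. *)
rewrite expnD big_nat_mul /= big_mkord.
rewrite [leRHS](bigID (fun i : 'I_(2 ^ j) => i \in A)) /= -[leLHS]addr0.
apply: lerD; last by apply: sumr_ge0 => i _; apply: sumr_ge0.
rewrite mulr_sumr; apply: ler_sum => i _.
rewrite -{2}[(i * 2 ^ q)%N]add0n big_addn mulSn addnK big_mkord mulr_sumr.
apply: ler_sum => r _; rewrite /F mulr_sumr (addnC r); apply: ler_sum => l _.
rewrite exprMn [leLHS]mulrCA -expr2 ler_wpM2l ?sqr_ge0// indicE.
case: (boolP (_ \in _)) => [|_]; last by rewrite mulr0 sqr_ge0.
rewrite inE /mid_cell /= in_itv /= mulr1 => /andP[h1 h2].
by apply: tent_mid; rewrite (ltW h1).
Qed.

Lemma measurable_cell_pattern j (A : {set 'I_(2 ^ j)}) :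
  measurable (cell_pattern tau A : set tauT).
Proof.
rewrite (_ : cell_pattern tau A = \bigcap_(i in [set: 'I_(2 ^ j)])
    [set w | point_count tauF (cell j i) w = (i \in A)%:R%:E]).
  apply: (@fin_bigcap_measurable _ tauT) => // i _.
  apply: (@measurable_point_count_eq _ tauT) => [k|]; first exact: measurable_sigma_family.
  exact: measurable_cell.
by apply/seteqP; split => w /= h' i; [move=> _|]; exact: h'.
Qed.

(** Integrating out the heights turns each square into [sigma2], and what remains is the expected
    number of points in the middle half on [E]; it is bounded below by the probability of having
    exactly one. *)
Lemma integral_mid_energy_ge J k (E : set T) : measurable (E : set tauT) ->
  (sigma2%:E * P (E `&` [set w | point_count tauF (mid_cell J k) w = 1%E]) <=
   \int[P]_w (mid_energy J k w * (\1_E w)%:E))%E.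
Proof.
move=> mE; have mE' : measurable E by exact: (@sub_tauT _ _ _ _ tau).
pose h (i : nat) (w : T) : R := \1_(mid_cell J k) (tau i w) * \1_E w.
have mh i : measurable_fun setT (h i : tauT -> R).
  by apply: measurable_funM; [exact: measurable_mid_term|exact: measurable_indic].
have mh' i : measurable_fun setT (h i : T -> R).
  apply: measurable_funM; last exact: measurable_indic.
  by apply: measurable_indic_comp => //; exact: measurable_mid_cell.
have ih i : P.-integrable setT (EFin \o h i).
  apply: measurable_bounded_integrable => //.
  - exact: (le_lt_trans (probability_le1 P measurableT) (ltry _)).
  - exists 1; split => // r r1 w _ /=; apply: le_trans (ltW r1).
    by rewrite /h !indicE; case: (_ \in _); case: (_ \in _);
      rewrite ?mulr0 ?mul0r ?mulr1 ?normr0 ?normr1.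
have E1 : (\int[P]_w (mid_energy J k w * (\1_E w)%:E) =
    \sum_(i <oo) \int[P]_w (a i w * a i w * h i w)%:E)%E.
  rewrite -integral_nneseries//; last 2 first.
  - move=> i; apply/measurable_EFinP; apply: measurable_funM => //; exact: measurable_funM.
  - by move=> i w _; rewrite lee_fin; apply: mulr_ge0; [rewrite -expr2 sqr_ge0|exact: mulr_ge0].
  apply: eq_integral => w _; rewrite muleC /mid_energy -nneseriesZl; last first.
    by move=> i _; rewrite lee_fin mulr_ge0// -expr2 sqr_ge0.
  by apply: eq_eseriesr => i _; rewrite -EFinM /h; congr EFin; ring.
have E2 : (\sum_(i <oo) \int[P]_w (a i w * a i w * h i w)%:E =
    sigma2%:E * \sum_(i <oo) \int[P]_w (h i w)%:E)%E.
  rewrite -nneseriesZl; last by move=> i _; apply: integral_ge0 => w _;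
    rewrite lee_fin mulr_ge0.
  apply: eq_eseriesr => i _.
  by have [_ ->] := integral_jumps_tau a_iid a_tau Pa_mean Pa_sq i i (mh i) (ih i);
    rewrite eqxx.
rewrite E1 E2; apply: lee_wpmul2l; first by rewrite lee_fin; exact: sigma2_ge0.
rewrite -integral_nneseries//; last 2 first.
- by move=> i; exact/measurable_EFinP.
- by move=> i w _; rewrite lee_fin mulr_ge0.
have mC : measurable [set w | point_count tauF (mid_cell J k) w = 1%E].
  by apply: (@measurable_point_count_eq _ _ _ tauF _ _ 1) => //; exact: measurable_mid_cell.
rewrite -[X in P X]setIT -integral_indic//; last exact: measurableI.
apply: le_integral_pointwise => [w|w]; first by rewrite lee_fin.
rewrite indicE; case: (boolP (_ \in _)); last first.
  by move=> _; apply: nneseries_ge0 => i _ _; rewrite lee_fin mulr_ge0.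
rewrite inE => -[Ew /= c1]; rewrite -[X in (X <= _)%E]c1 point_countE.
apply: lee_nneseries => [i _ _|i _]; first by rewrite lee_fin.
by rewrite lee_fin /h !indicE (mem_set Ew) mulr1.
Qed.

End lower.

(* [m ^_ n / m ^ n] is the probability that [n] uniform points lie in distinct
   cells among [m]; the union bound over pairs gives at least 1/2 if [n ^ 2 <= m]. *)
Lemma expn_le_ffact m n : (n * n <= m)%N -> (m ^ n <= 2 * m ^_ n)%N.
Proof.
have H k : (k <= m)%N -> (2 * m * m ^ k <= 2 * m * m ^_ k + k * k * m ^ k)%N.
  elim: k => [|k IH] km; first by rewrite ffactn0 expn0 addn0.
  have {}IH := IH (ltnW km).
  have le : (m ^_ k <= m ^ k)%N.
    by rewrite -(card_ord m) -(card_ord k) -card_inj_ffuns -card_ffun max_card.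
  rewrite ffactnSr expnS.
  move: (m ^_ k) (m ^ k)%N le IH => x y xy IH.
  have := leq_mul (leqnn m) IH; have := leq_mul (leqnn (m * k)) xy.
  have : (k + (m - k) = m)%N by lia.
  move: (m - k)%N => z; nia.
move=> nm; have [n0|n0] := posnP n; first by rewrite n0 ffactn0 expn0.
have h : (n <= m)%N by nia.
have m0 : (0 < m)%N by lia.
have := H n h; move: (m ^_ n) (m ^ n)%N => x y.
move=> h1; have : (n * n * y <= m * y)%N by rewrite leq_mul2r nm orbT.
by move=> h2; nia.
Qed.

Lemma up_log_square_le n : (0 < n)%N -> (2 ^ up_log 2 (n * n) <= 2 * (n * n))%N.
Proof.
move=> n0; have [n1|n1] := leqP (n * n) 1.
  have -> : (n = 1)%N by nia.
  by rewrite up_log1.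
have := up_log_bounds (isT : 1 < 2)%N n1 => /andP[h _].
move: h; case: (up_log 2 (n * n)) => [|u] /=; first by rewrite expn0; lia.
by rewrite expnS; lia.
Qed.

Lemma emeasurable_sum_cond d (T : measurableType d) (R : realType) I (r : seq I)
    (Q : pred I) (f : I -> T -> \bar R) : (forall i, measurable_fun setT (f i)) ->
  measurable_fun setT (fun w => \sum_(i <- r | Q i) f i w)%E.
Proof.
move=> mf; rewrite (_ : (fun w => _) = fun w => (\sum_(i <- [seq i <- r | Q i]) f i w)%E).
  exact: emeasurable_sum.
by apply/funext => w; rewrite big_filter.
Qed.

Lemma ge0_integral_sum_cond d (T : measurableType d) (R : realType)
    (mu : {measure set T -> \bar R}) I (r : seq I) (Q : pred I) (f : I -> T -> \bar R) :
  (forall i, measurable_fun setT (f i)) -> (forall i w, 0 <= f i w)%E ->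
  (\int[mu]_w \sum_(i <- r | Q i) f i w = \sum_(i <- r | Q i) \int[mu]_w f i w)%E.
Proof.
move=> mf f0; rewrite -[RHS]big_filter -ge0_integral_sum//.
by apply: eq_integral => w _; rewrite big_filter.
Qed.

Section lower.
Context (R : realType) (Pa : probability R R) d (T : measurableType d)
  (P : probability T R) (tau a : nat -> {RV P >-> R}) (lambda : R) (s : R -> T -> R).
Hypothesis lambda_gt0 : 0 < lambda.
Hypothesis tau_poisson : poisson_point_process lambda tau.
Hypothesis a_iid : iid_with_law Pa a.
Hypothesis a_tau : independent_families P (fun k => a k : T -> R) (fun k => tau k : T -> R).
Hypothesis Pa_mean : (\int[Pa]_x x%:E = 0)%E.
Hypothesis Pa_sq : Pa.-integrable setT (fun x => (x ^+ 2)%:E).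
Hypothesis Pa0 : Pa [set 0] = 0%E.
Hypothesis sE : forall t w, 0 <= t <= 1 ->
  s t w = \sum_(k \in [set k | 0 < tau k w <= t]) a k w.
Local Notation tauF := (fun k => tau k : T -> R).
Local Notation tauT := (sigma_family_type tauF).
Local Notation unit_itv := (`]0, 1]%classic : set R).
Local Notation err M w := (sq_L2_norm01 (fun x => s x w - greedy_approx M (s ^~ w) x)).

Let sigma2 : R := fine (\int[Pa]_x (x ^+ 2)%:E).

(** The lower bound of [mid_energy_le_err], cut off outside its pattern so that different patterns
    can be summed. *)
Definition pattern_energy j q (A : {set 'I_(2 ^ j)}) w : \bar R :=
  ((16 * 2 ^+ (j + q))^-1)%:E * (\sum_(i in A) \sum_(r < 2 ^ q)
    mid_energy tau a (j + q) (i * 2 ^ q + r) w * (\1_(cell_pattern tau A) w)%:E).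

Lemma kappa_ge0 j q : 0 <= (16 * 2 ^+ (j + q) : R)^-1.
Proof. by rewrite invr_ge0 mulr_ge0// exprn_ge0. Qed.

Lemma mid_indic_ge0 J k (E : set T) w : (0 <= mid_energy tau a J k w * (\1_E w)%:E)%E.
Proof. by rewrite mule_ge0 ?mid_energy_ge0 ?lee_fin. Qed.

Lemma pattern_energy_ge0 j q A w : (0 <= @pattern_energy j q A w)%E.
Proof.
rewrite mule_ge0 ?lee_fin ?kappa_ge0//.
by apply: sume_ge0 => i _; apply: sume_ge0 => r _; exact: mid_indic_ge0.
Qed.

Lemma measurable_mid_indic J k (E : set T) : measurable E ->
  measurable_fun setT (fun w => mid_energy tau a J k w * (\1_E w)%:E)%E.
Proof.
move=> mE; apply: emeasurable_funM; first exact: measurable_mid_energy.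
by apply/measurable_EFinP; exact: measurable_indic.
Qed.

Lemma measurable_pattern j (A : {set 'I_(2 ^ j)}) : measurable (cell_pattern tau A).
Proof. by apply: sub_tauT; exact: measurable_cell_pattern. Qed.

Lemma measurable_pattern_energy j q A : measurable_fun setT (@pattern_energy j q A).
Proof.
apply: measurable_funeM; apply: emeasurable_sum_cond => i; apply: emeasurable_sum_cond => r.
by apply: measurable_mid_indic; exact: measurable_pattern.
Qed.

Lemma pattern_energy_le_err j q (A : {set 'I_(2 ^ j)}) M w : regular tau a w -> (M <=
  #|A| * q)%N ->
  (@pattern_energy j q A w <= err M w)%E.
Proof.
move=> wreg MA; rewrite /pattern_energy indicE.
case: (boolP (_ \in _)) => [|_].
  rewrite inE => Aw; apply: le_trans (mid_energy_le_err sE wreg Aw MA).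
  by under eq_bigr => i _ do under eq_bigr => r _ do rewrite mule1.
under eq_bigr => i _ do under eq_bigr => r _ do rewrite mule0.
rewrite big1 ?mule0; first exact: sq_L2_norm01_ge0.
by move=> i _; rewrite big1.
Qed.

Lemma pattern_energy_neq0 j q A w : @pattern_energy j q A w != 0%E -> cell_pattern tau A w.
Proof.
rewrite /pattern_energy indicE; case: (boolP (_ \in _)) => [|_]; first by rewrite inE.
under eq_bigr => i _ do under eq_bigr => r _ do rewrite mule0.
rewrite big1 ?mule0 ?eqxx// => i _; exact: big1.
Qed.

Lemma cell_pattern_inj j (A B : {set 'I_(2 ^ j)}) w :
  cell_pattern tau A w -> cell_pattern tau B w -> A = B.
Proof.
move=> hA hB; apply/setP => i; have := etrans (esym (hA i)) (hB i) => -[/eqP].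
by rewrite eqr_nat; case: (i \in A); case: (i \in B).
Qed.

Lemma integral_pattern_energy_ge j q (A : {set 'I_(2 ^ j)}) :
  (((16 * 2 ^+ (j + q))^-1 * sigma2 * #|A|%:R / 2 * (lambda / 2 ^+ j) ^+ #|A| *
     expR (- lambda))%:E <= \int[P]_w (@pattern_energy j q A w))%E.
Proof.
rewrite /pattern_energy ge0_integralZl_EFin ?kappa_ge0//; last 2 first.
- by move=> w _; apply: sume_ge0 => i _; apply: sume_ge0 => r _; exact: mid_indic_ge0.
- apply: emeasurable_sum_cond => i; apply: emeasurable_sum_cond => r.
  by apply: measurable_mid_indic; exact: measurable_pattern.
rewrite -!mulrA EFinM; apply: lee_wpmul2l; first by rewrite lee_fin kappa_ge0.
rewrite ge0_integral_sum_cond//; last 2 first.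
- move=> i; apply: emeasurable_sum_cond => r.
  by apply: measurable_mid_indic; exact: measurable_pattern.
- by move=> i w; apply: sume_ge0 => r _; exact: mid_indic_ge0.
(* A middle half of level j + q has measure 2^-(j+q) / 2, a proportion 2^-q / 2 of the cell of level
   [j]. Over the 2^q subcells these add up to 1/2 per occupied cell. *)
pose c := (2 ^+ (j + q))^-1 / 2 * 2 ^+ j * (lambda / 2 ^+ j) ^+ #|A| * expR (- lambda) : R.
apply: (@le_trans _ _ (\sum_(i in A) \sum_(r < 2 ^ q) (sigma2 * c)%:E)%E).
  rewrite (eq_bigr (fun=> ((sigma2 * c) *+ 2 ^ q)%:E)); last first.
    by move=> i _; rewrite sumEFin sumr_const card_ord.
  rewrite sumEFin sumr_const lee_fin le_eqVlt; apply/orP; left; apply/eqP.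
  rewrite -[in RHS]mulr_natr -[in RHS]mulr_natr natrX /c exprD.
  have D1 : (2 ^+ j : R) != 0 by rewrite expf_neq0.
  have D2 : (2 ^+ q : R) != 0 by rewrite expf_neq0.
  set l := (lambda / 2 ^+ j) ^+ _; move: l (expR _) (2 ^+ j : R) (2 ^+ q : R) D1 D2.
  by move=> l e x y D1 D2; field; rewrite ?D1 ?D2.
apply: lee_sum => i iA.
rewrite ge0_integral_sum_cond//; last 2 first.
- by move=> r; apply: measurable_mid_indic; exact: measurable_pattern.
- by move=> r w; exact: mid_indic_ge0.
apply: lee_sum => r _.
have mA : measurable (cell_pattern tau A : set tauT) by exact: measurable_cell_pattern.
have := integral_mid_energy_ge a_iid a_tau Pa_mean Pa_sq (j + q) (i * 2 ^ q + r) mA.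
apply: le_trans.
rewrite EFinM; apply: lee_wpmul2l; first by rewrite lee_fin; exact: sigma2_ge0.
apply: prob_cell_pattern_mid iA _ _ _ => //.
- exact: measurable_mid_cell.
- exact: mid_cell_sub.
- exact: measure_mid_cell.
Qed.

(* [2 ^ level n] cells separate [n] jumps with probability at least 1/2, and
   [depth M n] further levels then contain [M] nonzero coefficients. *)
Definition level n := up_log 2 (n * n).
Definition depth M n := (M %/ n).+1.

(** Here 256 is 16 from [tent_mid] times four factors 2: the mass of the middle halves, the
    probability of distinct cells, 2^level <= 2 n^2, and the rounding of M / n in [depth]. *)
Lemma lower_term_le M n : (0 < n)%N ->
  sigma2 / 256 * n%:R^-1 * exp2_neg_ratio M n * poisson_pmf lambda n <=
  'C(2 ^ level n, n)%:R * ((16 * 2 ^+ (level n + depth M n))^-1 * sigma2 * n%:R / 2 *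
    (lambda / 2 ^+ level n) ^+ n * expR (- lambda)).
Proof.
move=> n0; set j := level n; set q := depth M n.
have nR : 0 < n%:R :> R by rewrite ltr0n.
have Dj : 0 < (2 ^+ j : R) by rewrite exprn_gt0.
have nj : (n * n <= 2 ^ j)%N by rewrite /j /level; apply: up_logP.
have jn : (2 ^+ j : R) <= 2 * n%:R ^+ 2.
  by have := up_log_square_le n0; rewrite -(ler_nat R) natrX !natrM expr2.
have e0 : 0 < 2 `^ (M%:R / n%:R) :> R by rewrite powR_gt0.
have qM : (2 ^+ q : R) <= 2 * 2 `^ (M%:R / n%:R).
  rewrite exprS ler_pM2l// -powR_mulrn// ler_powR// ?ler1n// ler_pdivlMr//.
  by rewrite -natrM ler_nat leq_trunc_div.
rewrite /exp2_neg_ratio (negbTE (lt0n_neq0 n0)) powRN /poisson_pmf lambda_gt0.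
have f0 : 0 < n`!%:R :> R by rewrite ltr0n fact_gt0.
have bin : 2^-1 / n`!%:R * (2 ^+ j) ^+ n <= 'C(2 ^ j, n)%:R :> R.
  rewrite mulrAC ler_pdivrMr// -natrM bin_ffact mulrC ler_pdivrMr//.
  by rewrite -!natrX -natrM mulnC ler_nat expn_le_ffact.
have s0 : 0 <= sigma2 by exact: sigma2_ge0.
have L0 : 0 < lambda ^+ n * expR (- lambda) by rewrite mulr_gt0 ?exprn_gt0 ?expR_gt0.
rewrite expr_div_n exprD.
set D := 2 ^+ j in Dj jn bin *; set E := 2 `^ _ in e0 qM *; set Q := 2 ^+ q in qM *.
have Q0 : 0 < Q by rewrite exprn_gt0.
have Dn : 0 < D ^+ n by rewrite exprn_gt0.
apply: (@le_trans _ _ ((2^-1 / n`!%:R * D ^+ n) * ((16 * (D * Q))^-1 * sigma2 * n%:R / 2 *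
    (lambda ^+ n / D ^+ n) * expR (- lambda)))); last first.
  apply: ler_wpM2r => //; rewrite !mulr_ge0 ?invr_ge0 ?expR_ge0//.
  - by rewrite ltW// !mulr_gt0.
  - by rewrite exprn_ge0// ltW.
  - exact: ltW.
rewrite [leLHS](_ : _ = (64 * (n%:R ^+ 2 * E))^-1 *
    (sigma2 / 4 * n%:R * (lambda ^+ n * expR (- lambda)) / n`!%:R)); last first.
  by field; rewrite !gt_eqF.
rewrite [leRHS](_ : _ = (16 * (D * Q))^-1 *
    (sigma2 / 4 * n%:R * (lambda ^+ n * expR (- lambda)) / n`!%:R)); last first.
  by field; rewrite !gt_eqF.
apply: ler_wpM2r.
  apply: divr_ge0; last exact: ltW.
  by apply: mulr_ge0; [apply: mulr_ge0 => //; exact: divr_ge0|exact: ltW].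
have X1 : 0 < 16 * (D * Q) by rewrite mulr_gt0// mulr_gt0.
have X2 : 0 < 64 * (n%:R ^+ 2 * E) by rewrite mulr_gt0// mulr_gt0// exprn_gt0.
rewrite lef_pV2//.
have := ler_pM (ltW Dj) (ltW Q0) jn qM; lra.
Qed.

Lemma mse_greedy_ge M :
  ((\sum_(n < M) sigma2 / 256 * n.+1%:R^-1 * exp2_neg_ratio M n.+1 *
      poisson_pmf lambda n.+1)%:E <= mse_greedy P s M)%E.
Proof.
have [N [mN N0 Nreg]] := regular_ae tau_poisson a_iid Pa0.
pose G n w := (\sum_(A : {set 'I_(2 ^ level n)} | #|A| == n)
  @pattern_energy (level n) (depth M n) A w)%E.
have G0 n w : (0 <= G n w)%E by apply: sume_ge0 => A _; exact: pattern_energy_ge0.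
have mG n : measurable_fun setT (G n).
  by apply: emeasurable_sum_cond => A; exact: measurable_pattern_energy.
have MD n : (0 < n)%N -> (M <= n * depth M n)%N.
  by move=> n0; rewrite mulnC ltnW// ltn_ceil.
apply: (@le_trans _ _ (\int[P]_w \sum_(n < M) G n.+1 w)%E); last first.
  apply: (@le_integral_measurable_l _ _ _ P N) => //.
  - by move=> w; apply: sume_ge0 => n _.
  - by move=> w; exact: sq_L2_norm01_ge0.
  - by apply: emeasurable_sum_cond => n; exact: mG.
  move=> w /Nreg wreg.
  apply: sum_disjoint_le => [|n _|n n' _ _ hn hn'].
  - exact: sq_L2_norm01_ge0.
  - apply: sum_disjoint_le => [|A /eqP An|A B _ _ /pattern_energy_neq0 hA
    /pattern_energy_neq0 hB].
    + exact: sq_L2_norm01_ge0.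
    + by apply: pattern_energy_le_err => //; rewrite An MD.
    + exact: cell_pattern_inj hA hB.
  (* Patterns for different [k] live on different partitions, but each fixes the total number of
     points, which keeps their events disjoint. *)
  have C k : G k w != 0%E -> point_count tauF unit_itv w = k%:R%:E.
    move=> hk; have [A Ak hA] : exists2 A : {set 'I_(2 ^ level k)}, #|A| = k &
      cell_pattern tau A w.
      apply: contrapT => h; move/eqP: hk; apply; rewrite /G big1// => A /eqP Ak.
      by apply/eqP; apply: contrapT => /negP /pattern_energy_neq0 hA; apply: h; exists A.
    by rewrite -Ak; exact: cell_pattern_count.
  have := etrans (esym (C _ hn)) (C _ hn') => -[/eqP]; rewrite eqr_nat eqSS => /eqP.
  exact: val_inj.
rewrite ge0_integral_sum_cond// -sumEFin; apply: lee_sum => n _.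
rewrite ge0_integral_sum_cond//; last 2 first.
- by move=> A; exact: measurable_pattern_energy.
- by move=> A w; exact: pattern_energy_ge0.
have := @lower_term_le M n.+1 isT; rewrite -lee_fin => /le_trans; apply.
pose c := (16 * 2 ^+ (level n.+1 + depth M n.+1))^-1 * sigma2 * n.+1%:R / 2 *
    (lambda / 2 ^+ level n.+1) ^+ n.+1 * expR (- lambda) : R.
apply: (@le_trans _ _ (\sum_(A : {set 'I_(2 ^ level n.+1)} | #|A| == n.+1) c%:E)%E).
  have E : #|[pred A : {set 'I_(2 ^ level n.+1)} | #|A| == n.+1]| = 'C(2 ^ level n.+1, n.+1).
    by rewrite -[in RHS](card_ord (2 ^ level n.+1)) -card_draws; apply: eq_card => A;
      rewrite !inE.
  by rewrite sumEFin sumr_const lee_fin E -[leRHS]mulr_natl.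
apply: lee_sum => A /eqP An; apply: le_trans (integral_pattern_energy_ge _ _).
by rewrite An.
Qed.

End lower.

(** * Poisson weights *)

Section poisson_sums.
Context (R : realType) (lambda : R).
Hypothesis lambda_gt0 : 0 < lambda.
Local Notation p := (poisson_pmf lambda).
Local Notation e := (@exp2_neg_ratio R).

Lemma exp2_neg_ratio_ge0 M n : 0 <= e M n.
Proof. by rewrite /exp2_neg_ratio; case: ifP => // _; exact: powR_ge0. Qed.

Lemma exp2_neg_ratio_le1 M n : e M n <= 1.
Proof.
rewrite /exp2_neg_ratio; case: ifPn => // n0.
by rewrite -[leRHS](powRr0 2) ler_powR ?ler1n// oppr_le0 divr_ge0.
Qed.

Lemma exp2_neg_ratio_ge_half M n : (0 < n)%N -> (M <= n)%N -> 2^-1 <= e M n.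
Proof.
move=> n0 Mn; rewrite /exp2_neg_ratio (negbTE (lt0n_neq0 n0)).
rewrite -[leLHS]powR_inv1// ler_powR ?ler1n// lerN2 ler_pdivrMr ?ltr0n//.
by rewrite mul1r ler_nat.
Qed.

Lemma pmfS n : n.+1%:R * p n.+1 = lambda * p n.
Proof.
rewrite /poisson_pmf lambda_gt0 factS natrM exprS.
have f0 : n`!%:R != 0 :> R by rewrite pnatr_eq0 -lt0n fact_gt0.
have n0 : n.+1%:R != 0 :> R by rewrite pnatr_eq0.
by move: (n.+1%:R : R) (n`!%:R : R) f0 n0 => x y y0 x0; field; rewrite ?x0 ?y0.
Qed.

(** This is M! k! <= (M + k)!; the factor [expR lambda] makes up for the two normalizations on the
    right. *)
Lemma pmf_addn_le M k : p (M + k) <= expR lambda * p M * p k.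
Proof.
rewrite /poisson_pmf lambda_gt0 exprD expRN.
have fpos n : 0 < n`!%:R :> R by rewrite ltr0n fact_gt0.
have E0 := expR_gt0 lambda.
rewrite [leRHS](_ : _ = lambda ^+ M * lambda ^+ k * (M`!%:R * k`!%:R)^-1 * (expR lambda)^-1);
  last by field; rewrite !gt_eqF.
apply: ler_wpM2r; first by rewrite invr_ge0 ltW.
apply: ler_wpM2l; first by rewrite mulr_ge0 ?exprn_ge0// ltW.
rewrite lef_pV2 ?posrE ?mulr_gt0//.
rewrite -natrM ler_nat -(bin_fact (leq_addr k M)) addKn.
by rewrite leq_pmull// bin_gt0 leq_addr.
Qed.

(** For n <= M the factor n is at most M. For n > M the recursion [pmfS] removes it, and 1 <= 2 e(M,
    n-1) restores the exponential weight at the shifted index. *)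
Lemma upper_sum_le (C : R) M (w : nat -> R) : (0 < M)%N -> 0 <= C ->
  (forall n, 0 <= w n) -> w 0%N = 0 ->
  (forall n, (0 < n)%N -> w n <= C * n%:R * e M n) ->
  (\sum_(n <oo) (w n * p n)%:E <=
   (C * (M%:R + 2 * lambda))%:E * \sum_(n <oo) (e M n * p n)%:E)%E.
Proof.
move=> M0 C0 w0 wz wC.
have ep0 n : (0 <= (e M n * p n)%:E)%E.
  by rewrite lee_fin mulr_ge0 ?exp2_neg_ratio_ge0 ?poisson_pmf_ge0.
(* The same series shifted by one place, so its sum is unchanged. *)
pose b n : R := if n is k.+1 then e M k * p k else 0.
have b0 n : (0 <= (b n)%:E)%E by case: n => [|n] //=; exact: ep0.
apply: (@le_trans _ _ (\sum_(n <oo) ((C * M%:R)%:E * (e M n * p n)%:E +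
    (C * (2 * lambda))%:E * (b n)%:E))%E).
  apply: lee_nneseries => [n _ _|n _]; first by rewrite lee_fin mulr_ge0 ?w0 ?poisson_pmf_ge0.
  rewrite -!EFinM -EFinD lee_fin; case: n => [|n].
    by rewrite wz mul0r !mulr0 addr0.
  apply: le_trans (ler_wpM2r (poisson_pmf_ge0 _ _) (wC n.+1 isT)) _.
  rewrite -!mulrA -mulrDr; apply: ler_wpM2l => //=.
  have pS := pmfS n; have e1 := exp2_neg_ratio_le1 M n.+1.
  have pn := poisson_pmf_ge0 lambda n; have pn1 := poisson_pmf_ge0 lambda n.+1.
  have en := exp2_neg_ratio_ge0 M n; have en1 := exp2_neg_ratio_ge0 M n.+1.
  have [Mn|nM] := leqP M n; last first.
    apply: (@le_trans _ _ (M%:R * (e M n.+1 * p n.+1))).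
      by apply: ler_wpM2r; [exact: mulr_ge0|rewrite ler_nat].
    by rewrite lerDl !mulr_ge0// ltW.
  have n0 := leq_trans M0 Mn.
  have h := exp2_neg_ratio_ge_half n0 Mn.
  apply: (@le_trans _ _ (lambda * p n)).
    by rewrite -pS mulrCA; apply: ler_piMl => //; rewrite mulr_ge0.
  rewrite -[leLHS]add0r; apply: lerD; first by rewrite mulr_ge0 ?mulr_ge0.
  rewrite [leRHS](_ : _ = lambda * p n * (2 * e M n)); last by ring.
  by apply: ler_peMr; [rewrite mulr_ge0// ltW|lra].
rewrite nneseriesD; last 2 first.
- by move=> n _ _; rewrite mule_ge0// lee_fin mulr_ge0.
- by move=> n _ _; rewrite mule_ge0// lee_fin !mulr_ge0// ltW.
rewrite nneseriesZl; last by move=> n _; exact: ep0.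
rewrite nneseriesZl; last by move=> n _; exact: b0.
have -> : (\sum_(n <oo) (b n)%:E = \sum_(n <oo) (e M n * p n)%:E)%E.
  rewrite nneseries_recl// add0e -(nneseries_addn 1)//.
  by apply: eq_eseriesr => n _; rewrite addn1.
have X0 : (0 <= \sum_(n <oo) (e M n * p n)%:E)%E by apply: nneseries_ge0 => n _ _; exact: ep0.
by rewrite -ge0_muleDl ?lee_fin ?mulr_ge0// ?(ltW lambda_gt0)// -EFinD -mulrDr.
Qed.

(** The tail n > M is absorbed by the term n = M: there the exponential weight is at most 1 = 2 e(M,
    M), and p_(M+k) <= e^lambda p_M p_k with the p_k summing to 1. *)
Lemma lower_sum_ge M : (0 < M)%N ->
  (\sum_(n <oo) (e M n * p n)%:E <=
   ((1 + 2 * expR lambda) * \sum_(n < M) e M n.+1 * p n.+1)%:E)%E.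
Proof.
move=> M0.
have ep0 n : (0 <= (e M n * p n)%:E)%E.
  by rewrite lee_fin mulr_ge0 ?exp2_neg_ratio_ge0 ?poisson_pmf_ge0.
rewrite (@nneseries_split _ _ 0 M.+1)// add0n.
rewrite big_mkord big_ord_recl /= [e M 0]/exp2_neg_ratio eqxx mul0r add0e sumEFin.
rewrite mulrDl mul1r EFinD leeD2l//.
have eM : 2 * e M M = 1.
  rewrite /exp2_neg_ratio (negbTE (lt0n_neq0 M0)) divff ?pnatr_eq0 -?lt0n//.
  by rewrite powR_inv1// divff.
have EM := exp2_neg_ratio_ge0 M M.
apply: (@le_trans _ _ (2 * expR lambda * (e M M * p M))%:E); last first.
  rewrite lee_fin; apply: ler_wpM2l; first by rewrite mulr_ge0 ?expR_ge0.
  case: M M0 ep0 eM EM => // m _ ep0 _ _; rewrite big_ord_recr /= lerDr.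
  by apply: sumr_ge0 => i _; rewrite mulr_ge0 ?exp2_neg_ratio_ge0 ?poisson_pmf_ge0.
rewrite -(nneseries_addn M.+1)//.
apply: (@le_trans _ _ (\sum_(n <oo) (2 * expR lambda * (e M M * p M))%:E * (p n.+1)%:E)%E).
  apply: lee_nneseries => [n _ _|n _]; first exact: ep0.
  rewrite -EFinM lee_fin addnC addSnnS.
  apply: le_trans (ler_piMl (poisson_pmf_ge0 _ _) (exp2_neg_ratio_le1 _ _)) _.
  apply: le_trans (pmf_addn_le _ _) _.
  rewrite [leRHS](_ : _ = expR lambda * p M * p n.+1 * (2 * e M M)); last by ring.
  by rewrite eM mulr1.
rewrite nneseriesZl; last by move=> n _; rewrite lee_fin poisson_pmf_ge0.
rewrite -[leRHS]mule1; apply: lee_wpmul2l.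
  by rewrite lee_fin !mulr_ge0 ?expR_ge0 ?poisson_pmf_ge0.
rewrite -(pmf_sum1 lambda_gt0) [leRHS]nneseries_recl//; last by move=> n _;
  rewrite lee_fin poisson_pmf_ge0.
rewrite -(nneseries_addn 1); last by move=> n; rewrite lee_fin poisson_pmf_ge0.
rewrite [X in (_ <= _ + X)%E](_ : _ = \sum_(n <oo) (p n.+1)%:E)%E.
  by rewrite leeDr// lee_fin poisson_pmf_ge0.
by apply: eq_eseriesr => n _; rewrite addn1.
Qed.

End poisson_sums.

(** * Moments of the jump law, and assembly of the constants *)

Section jump_law.
Context (R : realType) (Pa : probability R R).
Hypothesis Pa_density : admits_density Pa.
Hypothesis Pa_mean : ('E_Pa[idfun] = 0)%E.
Hypothesis Pa_var : ('V_Pa[idfun] < +oo)%E.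

Lemma jump_mean : (\int[Pa]_x x%:E = 0)%E.
Proof. by rewrite -Pa_mean unlock. Qed.

Lemma jump_sq_integrable : Pa.-integrable setT (fun x => (x ^+ 2)%:E).
Proof.
apply/integrableP; split; first by apply/measurable_EFinP; exact: measurable_funX.
apply: le_lt_trans Pa_var; rewrite /variance unlock Pa_mean unlock.
rewrite le_eqVlt; apply/orP; left; apply/eqP; apply: eq_integral => x _ /=.
rewrite ger0_norm ?sqr_ge0// -[in RHS]/((x - 0) * (x - 0))%:E.
by rewrite subr0 expr2.
Qed.

Lemma jump_atomless : Pa [set 0] = 0%E.
Proof.
case: Pa_density => p [_ _ ->]; last exact: measurable_set1.
by rewrite integral_set1.
Qed.

(** A vanishing second moment would concentrate [Pa] at 0, where it has no atom. *)
Lemma jump_sq_gt0 : 0 < fine (\int[Pa]_x (x ^+ 2)%:E).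
Proof.
rewrite lt_neqAle fine_ge0 ?andbT; last first.
  by apply: integral_ge0 => x _; rewrite lee_fin sqr_ge0.
apply/eqP => h; have /integrableP[mf _] := jump_sq_integrable.
have h0 : (\int[Pa]_x (x ^+ 2)%:E = 0)%E.
  by rewrite -(fineK (integrable_fin_num _ jump_sq_integrable)) ?h//= -h.
have [+ _] := ae_eq_integral_abs Pa measurableT mf.
rewrite (_ : integral _ _ _ = 0%E); last first.
  rewrite -[RHS]h0; apply: eq_integral => x _.
  by rewrite gee0_abs// lee_fin sqr_ge0.
move=> /(_ erefl) [N [mN N0 sub]].
have : (Pa setT <= Pa N + Pa [set 0%R])%E.
  apply: le_trans (measureU2 _ _ _) => //.
  apply: le_measure; rewrite ?inE//; first exact: measurableU.
  move=> x _; have [->|x0] := eqVneq x 0; first by right.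
  left; apply: sub => /= /(_ Logic.I) [] /eqP; rewrite sqrf_eq0; exact/negP.
rewrite N0 jump_atomless adde0 probability_setT.
by rewrite lee_fin ler10.
Qed.

End jump_law.

Lemma expectation_poisson (R : realType) (lambda : R) d' (T' : measurableType d')
    (Q : probability T' R) (N : {RV Q >-> nat}) (f : nat -> R) :
  0 < lambda -> (forall n, 0 <= f n) ->
  (forall A : set nat, distribution Q N A = poisson_prob lambda 0 A) ->
  ('E_Q[fun w => f (N w)] = \sum_(n <oo) (f n * poisson_pmf lambda n)%:E)%E.
Proof.
move=> l0 f0 NQ; rewrite unlock.
have mN n : measurable (N @^-1` [set n]).
  by rewrite -[X in measurable X]setTI; exact: (measurable_funP N).
transitivity (\int[Q]_w \sum_(n <oo) ((f n)%:E * (\1_(N @^-1` [set n]) w)%:E))%E.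
  apply: eq_integral => w _; rewrite (@nneseries_single _ _ (N w)).
  - by rewrite indicE mem_set// mule1.
  - by rewrite mule_ge0// lee_fin.
  - move=> n nN; rewrite indicE memNset ?mule0//= => /esym/eqP.
    exact/negP.
rewrite integral_nneseries//; last 2 first.
- move=> n; apply: measurable_funeM; apply/measurable_EFinP; exact: measurable_indic.
- by move=> n w _; rewrite mule_ge0// lee_fin.
apply: eq_eseriesr => n _; rewrite ge0_integralZl_EFin//; last first.
  by apply/measurable_EFinP; exact: measurable_indic.
rewrite integral_indic// setIT EFinM; congr (_ * _)%E.
by rewrite -poisson_prob1// -NQ.
Qed.

Theorem theorem1 (R : realType) (lambda : R) (Pa : probability R R)
  (d : measure_display) (T : measurableType d) (P : probability T R)
  (s : R -> T -> R)
  (d' : measure_display) (T' : measurableType d') (Q : probability T' R)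
  (N : {RV Q >-> nat})
  (lambda_gt0 : 0 < lambda)
  (Pa_density : admits_density Pa)
  (Pa_mean : ('E_Pa[idfun] = 0)%E)
  (Pa_var : ('V_Pa[idfun] < +oo)%E)
  (s_cpp : is_compound_poisson P lambda Pa s)
  (N_poisson : forall A : set nat, distribution Q N A = poisson_prob lambda 0 A) :
  exists C1 C2 : R, [/\ 0 < C1, 0 < C2 &
    forall M : nat, (1 <= M)%N ->
      ((C1 * M%:R^-1)%:E * 'E_Q[fun w => exp2_neg_ratio M (N w)]
         <= mse_greedy P s M)%E /\
      (mse_greedy P s M
         <= (C2 * M%:R)%:E * 'E_Q[fun w => exp2_neg_ratio M (N w)])%E].
Proof.
have [tau [a [tau_poisson a_iid a_tau sE]]] := s_cpp.
have mean0 := jump_mean Pa_mean; have sq := jump_sq_integrable Pa_mean Pa_var.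
have Pa0 := jump_atomless Pa_density.
have sig := jump_sq_gt0 Pa_density Pa_mean Pa_var.
set sigma2 := fine (\int[Pa]_x (x ^+ 2)%:E) in sig.
have e0 := expR_gt0 lambda.
have E M := expectation_poisson lambda_gt0 (@exp2_neg_ratio_ge0 R M) N_poisson.
have D0 : 0 < 1 + 2 * expR lambda by rewrite addr_gt0// mulr_gt0.
(* The first constant combines [lower_term_le] with [lower_sum_ge]. In the second, 4 covers the
   rounding of M / n and 1 + 2 lambda absorbs M + 2 lambda into a multiple of M. *)
exists (sigma2 / 256 / (1 + 2 * expR lambda)), (4 * sigma2 * (1 + 2 * lambda)).
split; [by rewrite !divr_gt0|by rewrite !mulr_gt0// addr_gt0// mulr_gt0|].
move=> M M0; have MR : 0 < M%:R :> R by rewrite ltr0n.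
rewrite E; split.
  apply: le_trans (mse_greedy_ge lambda_gt0 tau_poisson a_iid a_tau mean0 sq Pa0 sE M).
  apply: le_trans (lee_wpmul2l _ (lower_sum_ge lambda_gt0 M0)) _.
    by rewrite lee_fin !divr_ge0// ltW.
  rewrite -EFinM lee_fin.
  rewrite [leLHS](_ : _ = sigma2 / 256 / M%:R *
      \sum_(n < M) exp2_neg_ratio M n.+1 * poisson_pmf lambda n.+1); last first.
    by field; rewrite !gt_eqF.
  (* The indices n + 1 are at most M, so 1 / (n + 1) >= 1 / M; this is the M^-1 of the statement. *)
  rewrite mulr_sumr; apply: ler_sum => n _; rewrite -!mulrA.
  do 2 (apply: ler_wpM2l; first by rewrite ?invr_ge0// ltW).
  apply: ler_wpM2r; first by rewrite mulr_ge0 ?exp2_neg_ratio_ge0 ?poisson_pmf_ge0.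
  by rewrite lef_pV2 ?posrE ?ltr0n// ler_nat.
apply: le_trans (mse_greedy_le lambda_gt0 tau_poisson a_iid a_tau mean0 sq sE M0) _.
apply: (@le_trans _ _ ((4 * sigma2 * (M%:R + 2 * lambda))%:E *
    \sum_(n <oo) (exp2_neg_ratio M n * poisson_pmf lambda n)%:E)%E).
  apply: upper_sum_le => //.
  - by rewrite mulr_ge0// ltW.
  - by move=> n; exact: upper_weight_ge0.
  - by rewrite /upper_weight mulr0 mul0r.
  move=> n n0; rewrite /upper_weight -/sigma2.
  have nR : 0 < n%:R :> R by rewrite ltr0n.
  rewrite [leRHS](_ : _ = sigma2 * n%:R * (4 * exp2_neg_ratio M n)); last by ring.
  apply: ler_wpM2l; first by rewrite mulr_ge0// ltW.
  rewrite /exp2_neg_ratio (negbTE (lt0n_neq0 n0)).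
  rewrite -powR_mulrn// -powRN.
  (* Since M / n is at most the rounded (M - 1) / n plus 1, the exponent 2 covers the rounding with
     room to spare. *)
  have -> : 4 = 2 `^ 2 :> R by rewrite powR_mulrn// expr2; ring.
  rewrite -powRD ?pnatr_eq0 ?implybT// ler_powR ?ler1n//.
  have : M%:R / n%:R <= ((M - 1) %/ n)%:R + 1 :> R.
    rewrite ler_pdivrMr// natr1 -natrM ler_nat.
    by have := ltn_ceil (M - 1) n0; rewrite -(ltn_add2r 1) subnK// addn1 ltnS.
  lra.
apply: lee_wpmul2r; first by apply: nneseries_ge0 => n _ _;
  rewrite lee_fin mulr_ge0 ?exp2_neg_ratio_ge0 ?poisson_pmf_ge0.
rewrite lee_fin -!mulrA; apply: ler_wpM2l => //; apply: ler_wpM2l; first exact: ltW.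
have M1 : 0 <= M%:R - 1 :> R by rewrite subr_ge0 ler1n.
by have := mulr_ge0 (ltW lambda_gt0) M1; lra.
Qed.
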